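(* Let $\omega>0$ be irrational, let $k\ge1$ be an integer, and let $\Omega_0=|k|\sqrt{k^2+2\omega}$. The map $$f(v;\Omega)=-i\Omega\,\partial_tv-\partial_{ss}v+\omega(1-|v|^{-2})v$$ has a global bifurcation of periodic traveling wave solutions from $(v,\Omega)=(1,\Omega_0)$: zeros of $f(\cdot;\Omega)$ of the form $v(t,s)=v(t+ks)$ with $v$ a $2\pi$-periodic function of one variable. If $a_1,\dots,a_n\in\mathbb{C}$ are pairwise distinct with $\omega a_j=\sum_{i\ne j}\frac{a_j-a_i}{|a_j-a_i|^2}$ for all $j=1,\dots,n$, these give solutions of the filament problem $$\partial_tu_j=i\Big(\partial_{ss}u_j+\sum_{i=1,\,i\ne j}^n\frac{u_j-u_i}{|u_j-u_i|^2}\Big),\qquad j=1,\dots,n,$$ of the form $$u_j(t,s)=a_je^{i\omega t}v(\Omega t+ks),$$ where $v$ is $2\pi$-periodic.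
   Context: Traveling waves are sought in the space of functions $v(t,s)=\sum_{l\in\mathbb{Z}}v_l\,e^{il(t+ks)}$ with real coefficients $v_l\in\mathbb{R}$ (equivalently, $2\pi$-periodic $v(\zeta)$, $\zeta=t+ks$, with $v(-\zeta)=\overline{v(\zeta)}$) that do not vanish anywhere; $v\equiv1$ is a zero of $f(\cdot;\Omega)$ for every $\Omega$ (the trivial branch). Global bifurcation from $(1,\Omega_0)$ is meant in the standard (Rabinowitz) sense of topological bifurcation theory: $(1,\Omega_0)$ belongs to the closure of the set of zeros $(v,\Omega)$, $\Omega>0$, with $v\not\equiv1$, and the connected component of this closure containing $(1,\Omega_0)$ either is not compact in the domain of the problem (it is unbounded, or $\min|v|$ is not bounded away from $0$ on it, or $\Omega$ is not bounded away from $0$ on it), or it contains another point $(1,\Omega_1)$ of the trivial branch with $\Omega_1\ne\Omega_0$. *)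

(* Defs.v *)
From HB Require Import structures.
From mathcomp Require Import all_boot all_order all_algebra.
From mathcomp Require Import all_classical all_reals all_analysis.
From mathcomp Require Import complex.

Set Implicit Arguments.
Unset Strict Implicit.
Unset Printing Implicit Defensive.

Import Order.TTheory GRing.Theory Num.Theory.
Import numFieldNormedType.Exports.

Local Open Scope ring_scope.
Local Open Scope classical_set_scope.

(* [Rcomplex R] is [R[i]] seen as a real normed space, its norm being the
   [R]-valued modulus; the instances below add the topology of that norm, so
   that [derive1], [derivable], [{uniform _ -> _}] apply to complex-valued
   functions of real variables. *)
Section RcomplexNormedModule.
Variable R : realType.

Lemma Rcomplex_normrZ (l : R) (x : Rcomplex R) : `|l *: x| = `|l| * `|x|.
Proof.
case: x => a b; rewrite /Num.norm /= /ComplexField.Normc.normc /=.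
by rewrite !exprMn -mulrDr sqrtrM ?sqr_ge0// sqrtr_sqr.
Qed.

HB.instance Definition _ :=
  PseudoMetric.copy (Rcomplex R) (pseudoMetric_normed (Rcomplex R)).
HB.instance Definition _ := isPointed.Build (Rcomplex R) 0.
HB.instance Definition _ :=
  NormedZmod_PseudoMetric_eq.Build R (Rcomplex R) erefl.
HB.instance Definition _ :=
  PseudoMetricNormedZmod_Lmodule_isNormedModule.Build R (Rcomplex R)
    Rcomplex_normrZ.

End RcomplexNormedModule.

Section Filaments.
Variable R : realType.
Local Notation C := (Rcomplex R).

Definition cI : C := (0 +i* 1)%C.
Definition cexp (x : R) : C := (cos x +i* sin x)%C.
Definition cconj (z : C) : C := conjc z.

Definition d_t (u : R -> R -> C) (t s : R) : C := (u^~ s)^`() t.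
Definition d_ss (u : R -> R -> C) (t s : R) : C := (u t)^`(2) s.

Definition trav_map (omega : R) (v : R -> R -> C) (Omega : R) (t s : R) : C :=
  - (cI * (Omega *: d_t v t s)) - d_ss v t s
  + (omega * (1 - `|v t s| ^- 2)) *: v t s.

Definition twave (k : int) (v : R -> C) (t s : R) : C := v (t + k%:~R * s).

(* Real Fourier coefficients amount to [v (- z) = conj (v z)]. *)
Definition profile (v : R -> C) : Prop :=
  [/\ forall z, derivable v z 1,
      forall z, derivable v^`() z 1,
      continuous v^`(2),
      forall z, v (z + 2 * pi) = v z &
      forall z, v (- z) = cconj (v z)].

Definition jet2 (v : R -> C) :
    {uniform R -> C} * {uniform R -> C} * {uniform R -> C} :=
  (v, v^`(), v^`(2)).

(* On profiles this is the topology of the norm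
   sup |v| + sup |v'| + sup |v''|; functions that are not C^2 are excluded by
   [wave_domain]. *)
Definition C2top := initial_topology jet2.

Definition ambient : topologicalType := (C2top * R)%type.

Definition wave_domain : set ambient :=
  [set p | [/\ profile p.1, forall z, (p.1 : R -> C) z != 0 & 0 < p.2]].

Definition zeros (omega : R) (k : int) : set ambient :=
  wave_domain `&` [set p | forall t s, trav_map omega (twave k p.1) p.2 t s = 0].

Definition triv (Omega : R) : ambient := (cst 1 : R -> C, Omega).

Definition nontrivial_zeros (omega : R) (k : int) : set ambient :=
  zeros omega k `&` [set p | (p.1 : R -> C) <> cst 1].

Definition C2_bounded (A : set ambient) : Prop :=
  exists M : R, forall p, A p -> `|p.2| <= M /\
    forall z, [/\ `|(p.1 : R -> C) z| <= M,
                  `|(p.1 : R -> C)^`() z| <= M &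
                  `|(p.1 : R -> C)^`(2) z| <= M].

Definition modulus_away_from_0 (A : set ambient) : Prop :=
  exists2 d : R, 0 < d & forall p, A p -> forall z, d <= `|(p.1 : R -> C) z|.

Definition frequency_away_from_0 (A : set ambient) : Prop :=
  exists2 d : R, 0 < d & forall p, A p -> d <= p.2.

(* The closure is relative to [wave_domain]. *)
Definition bif_set (omega : R) (k : int) : set ambient :=
  wave_domain `&` closure (nontrivial_zeros omega k).

Definition global_bifurcation (omega : R) (k : int) (Omega0 : R) : Prop :=
  let B := connected_component (bif_set omega k) (triv Omega0) in
  bif_set omega k (triv Omega0) /\
  ([\/ ~ C2_bounded B, ~ modulus_away_from_0 B | ~ frequency_away_from_0 B]
   \/ exists2 Omega1, Omega1 != Omega0 & B (triv Omega1)).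

Definition filament_solution (n : nat) (u : 'I_n -> R -> R -> C) : Prop :=
  (forall j t s, derivable ((u j)^~ s) t 1) /\
  (forall j t s, derivable (u j t) s 1) /\
  (forall j t s, derivable (u j t)^`() s 1) /\
  (forall i j t s, i != j -> u i t s != u j t s) /\
  (forall j t s, d_t (u j) t s =
     cI * (d_ss (u j) t s +
       \sum_(i < n | i != j)
          `|u j t s - u i t s| ^- 2 *: (u j t s - u i t s))).

Definition central_configuration (omega : R) (n : nat) (a : 'I_n -> C) : Prop :=
  injective a /\
  forall j, omega *: a j =
    \sum_(i < n | i != j) `|a j - a i| ^- 2 *: (a j - a i).

Definition filament_wave (omega : R) (k : int) (n : nat) (a : 'I_n -> C)
    (v : R -> C) (Omega : R) (j : 'I_n) (t s : R) : C :=
  a j * cexp (omega * t) * v (Omega * t + k%:~R * s).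

End Filaments.

(* Main.v *)
Require Import Defs.
From mathcomp Require Import all_boot all_order all_algebra.
From mathcomp Require Import all_classical all_reals all_analysis.
From mathcomp Require Import complex ring lra.
Import Order.TTheory GRing.Theory Num.Theory.
Import numFieldNormedType.Exports.
Local Open Scope classical_set_scope.
Local Open Scope ring_scope.

(** Put [beta = omega / k^2] and [sigma = Omega / (2 * k^2)]. A wave [v (t + k s)] is a
    zero of [f] when [v'' + 2 i sigma v' = beta (1 - |v|^-2) v]: a planar particle
    moves in a constant magnetic field and in a central field. In the frame
    turning at the Larmor speed [sigma] only the central force with potential
    [alpha r^2 / 2 + beta ln r] remains, where [alpha = sigma^2 - beta]. This
    motion is integrable, so the branch can be described by explicit integrals,
    and the topological part of the argument takes place in a plane.

    The square [U] of the distance obeys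
    [U'^2 / 4 = 2 E U - L^2 - alpha U^2 - beta U ln U]. Measured in units of the
    geometric mean of its two turning values, [U] is the exponential of
    [2 arcsinh y], the variable [y] oscillates between [- s] and [s], and the
    right-hand side is [2 U (s^2 - y^2)] times a function [gain] that is positive and
    depends on one more parameter, [eps], its value at [y = s]. In terms of [x]
    with [y = s cos x] nothing is singular any more: time and polar angle are
    primitives of positive functions of [x]. The scale is determined by the period
    [2 pi], and [sigma] by the requirement that [v] has winding number zero. For
    every [(s, eps)] this yields a periodic, reversible function [v]; it is a
    zero of [f] when [alpha = sigma^2 - beta], which is one real equation,
    [mismatch = 0], in the plane of the parameters ([wave_zeros]).

    For [s = 0] this equation has the only solution [eps = 1 / 2], which is the point
    [(1, Omega0)]. For every [s] the mismatch is negative when [eps > 1]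
    ([mismatch_lt0]), and it is positive when [eps] is small, uniformly for bounded
    [s], because the orbit then stays for a long time near its outer turning point
    ([mismatch_gt0]). A parity count on grids ([zeros_not_separated]) and the
    connectedness of limits of chains ([reach_component]) show that the component of
    the zero set through [(0, 1 / 2)] contains points with every amplitude [s]
    ([zero_continuum]). It is mapped continuously to waves ([cts_branch]), hence into
    the component [B] of the bifurcation point ([branch_reaches]). As the quotient of
    the largest and the smallest value of [|v|] is [rho s ^ 2 > s]
    ([modulus_ratio]), [B] cannot be bounded with [|v|] bounded away from zero.

    The statement on filaments is a computation ([wave_filament]). *)

Set Implicit Arguments.
Unset Strict Implicit.
Unset Printing Implicit Defensive.

(** * Continuity and its rules *)
Section ContinuityRules.
Variables (R : realType) (T : topologicalType).
Implicit Types f g : T -> R.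

Lemma cts_cst (U : topologicalType) (a : U) : continuous (fun _ : T => a).
Proof. by move=> x; exact: cvg_cst. Qed.

Lemma cts_id : continuous (fun x : T => x).
Proof. by move=> x; exact: cvg_id. Qed.

Lemma cts_comp (U V : topologicalType) (g : U -> V) (f : T -> U) :
  continuous g -> continuous f -> continuous (fun x => g (f x)).
Proof. by move=> cg cf x; apply: (@continuous_comp _ _ _ f g); [exact: cf|exact: cg]. Qed.

Lemma cts_pair (U V : topologicalType) (f : T -> U) (g : T -> V) :
  continuous f -> continuous g -> continuous (fun x => (f x, g x)).
Proof. by move=> cf cg x; apply: cvg_pair; [exact: cf|exact: cg]. Qed.

Lemma cts_fst (U V : topologicalType) (f : T -> U * V) :
  continuous f -> continuous (fun x => (f x).1).
Proof. by move=> cf; apply: cts_comp => // x; apply: cvg_fst. Qed.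

Lemma cts_snd (U V : topologicalType) (f : T -> U * V) :
  continuous f -> continuous (fun x => (f x).2).
Proof. by move=> cf; apply: cts_comp => // x; apply: cvg_snd. Qed.

Lemma cts_add f g : continuous f -> continuous g ->
  continuous (fun x => f x + g x).
Proof. by move=> cf cg x; apply: cvgD; [exact: cf|exact: cg]. Qed.

Lemma cts_opp f : continuous f -> continuous (fun x => - f x).
Proof. by move=> cf x; apply: cvgN; exact: cf. Qed.

Lemma cts_mul f g : continuous f -> continuous g ->
  continuous (fun x => f x * g x).
Proof. by move=> cf cg x; apply: cvgM; [exact: cf|exact: cg]. Qed.

Lemma cts_exp f n : continuous f -> continuous (fun x => f x ^+ n).
Proof.
move=> cf; elim: n => [|n IH]; first exact: cts_cst.
by under eq_fun do rewrite exprS; exact: cts_mul.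
Qed.

Lemma cts_inv f : (forall x, f x != 0) -> continuous f ->
  continuous (fun x => (f x)^-1).
Proof. by move=> f0 cf x; apply: cvgV => //; exact: cf. Qed.

Lemma cts_sqrt f : continuous f -> continuous (fun x => Num.sqrt (f x)).
Proof. by apply: cts_comp; exact: sqrt_continuous. Qed.

Lemma cts_expR f : continuous f -> continuous (fun x => expR (f x)).
Proof. by apply: cts_comp; exact: continuous_expR. Qed.

Lemma cts_cos f : continuous f -> continuous (fun x => cos (f x)).
Proof. by apply: cts_comp; exact: continuous_cos. Qed.

Lemma cts_sin f : continuous f -> continuous (fun x => sin (f x)).
Proof. by apply: cts_comp; exact: continuous_sin. Qed.

End ContinuityRules.

Ltac cts :=
  try match goal with H : continuous ?f |- continuous ?f => exact: H end;
  lazymatch goal with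
  | |- forall x, continuous_at x (fun y => y) => exact: cts_id
  | |- forall x, continuous_at x (fun _ => ?c) => exact: cts_cst
  | |- forall x, continuous_at x (fun y => (_, _)) => apply: cts_pair; cts
  | |- forall x, continuous_at x (fun y => @GRing.add _ _ _) => apply: cts_add; cts
  | |- forall x, continuous_at x (fun y => @Algebra.add _ _ _) => apply: cts_add; cts
  | |- forall x, continuous_at x (fun y => @GRing.opp _ _) => apply: cts_opp; cts
  | |- forall x, continuous_at x (fun y => @Algebra.opp _ _) => apply: cts_opp; cts
  | |- forall x, continuous_at x (fun y => @GRing.mul _ _ _) => apply: cts_mul; cts
  | |- forall x, continuous_at x (fun y => @GRing.inv _ _) => apply: cts_inv; cts
  | |- forall x, continuous_at x (fun y => @GRing.exp _ _ _) => apply: cts_exp; cts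
  | |- forall x, continuous_at x (fun y => Num.sqrt _) => apply: cts_sqrt; cts
  | |- forall x, continuous_at x (fun y => expR _) => apply: cts_expR; cts
  | |- forall x, continuous_at x (fun y => cos _) => apply: cts_cos; cts
  | |- forall x, continuous_at x (fun y => sin _) => apply: cts_sin; cts
  | |- forall x, continuous_at x (fun y => _.1) => apply: cts_fst; cts
  | |- forall x, continuous_at x (fun y => _.2) => apply: cts_snd; cts
  | |- forall x, continuous_at x (@fst _ _) => by move=> ?; apply: cvg_fst
  | |- forall x, continuous_at x (@snd _ _) => by move=> ?; apply: cvg_snd
  | |- forall x, continuous_at x (@GRing.mul _ ?b) =>
      apply: (@cts_mul _ _ (fun _ => b) (fun y => y)); cts
  | |- forall x, continuous_at x (@cos _) => exact: continuous_cos
  | |- forall x, continuous_at x (@sin _) => exact: continuous_sin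
  | |- forall x, continuous_at x _ => try exact: cts_cst
  | |- _ => idtac
  end.

(** * Zero sets crossing a rectangle *)
(** The parity of the labelled sign changes in column [i] does not depend on [i]:
    the sign changes on the four edges of a cell are even in number and carry
    one label, and the horizontal ones cancel between neighbouring cells. *)
Lemma grid_parity (N : nat) (s lab : nat -> nat -> bool) :
  (forall i, (i <= N)%N -> s i 0%N) ->
  (forall i, (i <= N)%N -> ~~ s i N) ->
  (forall j, (j < N)%N -> s 0%N j (+) s 0%N j.+1 -> lab 0%N j) ->
  (forall j, (j < N)%N -> s N j (+) s N j.+1 -> ~~ lab N j) ->
  (forall i j, (i < N)%N -> (j < N)%N -> exists l : bool,
     [/\ s i j (+) s i j.+1 -> lab i j = l,
         s i.+1 j (+) s i.+1 j.+1 -> lab i.+1 j = l,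
         s i j (+) s i.+1 j -> lab i j = l &
         s i j.+1 (+) s i.+1 j.+1 -> lab i j.+1 = l]) -> False.
Proof.
move=> bot top lft rgt cell.
pose v i j := (s i j (+) s i j.+1) && lab i j.
pose w i j := (s i j (+) s i.+1 j) && lab i j.
pose m i n := \big[addb/false]_(0 <= j < n) v i j.
have vw i n : (i < N)%N -> (n <= N)%N ->
    m i n (+) m i.+1 n = w i 0%N (+) w i n.
  move=> iN; elim: n => [_|n IH nN]; first by rewrite /m !big_geq// !addbb.
  rewrite /m !big_nat_recr//= -/(m _ _) -/(m _ _).
  have {IH} := IH (ltnW nN).
  have [l []] := cell i n iN nN.
  rewrite /v /w.
  rewrite -[_ && lab i 0%N]/(w i 0%N).
  move: (m i n) (m i.+1 n) (w i 0%N) => p q r.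
  move: (lab i n) (lab i.+1 n) (lab i n.+1) => x y z.
  case: (s i n); case: (s i n.+1); case: (s i.+1 n); case: (s i.+1 n.+1) => /=;
    case: x; case: y; case: z; case: l => h1 h2 h3 h4;
    try (by have := h1 isT); try (by have := h2 isT);
    try (by have := h3 isT); try (by have := h4 isT);
    by case: p; case: q; case: r.
have mi i : (i <= N)%N -> m i N = m 0%N N.
  elim: i => // i IH iN; rewrite -(IH (ltnW iN)).
  have := vw i N iN (leqnn N).
  rewrite /w (bot _ (ltnW iN)) (bot _ iN).
  rewrite (negbTE (top _ (ltnW iN))) (negbTE (top _ iN)) /=.
  by case: (m i N); case: (m i.+1 N).
have mN : m N N = false.
  rewrite /m big_nat_cond; apply: big1 => j /andP[/andP[_ jN] _].
  by apply/negbTE/negP => /andP[h]; rewrite (negbTE (rgt j jN h)).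
have m0 n : (n <= N)%N -> m 0%N n = ~~ s 0%N n.
  elim: n => [_|n IH nN]; first by rewrite /m big_geq// (bot 0%N).
  rewrite /m big_nat_recr//= -/(m 0%N n) (IH (ltnW nN)).
  have : v 0%N n = s 0%N n (+) s 0%N n.+1.
    by rewrite /v; case: (boolP (_ (+) _)) => // h; rewrite (lft n nN h).
  by move=> ->; case: (s 0%N n); case: (s 0%N n.+1).
by have := m0 N (leqnn N); rewrite -(mi N (leqnn N)) mN (negbTE (top _ _)).
Qed.

Section Crossing.
Variable R : realType.

Lemma sign_change_segment (H : R * R -> R) (p q : R * R) :
  continuous H -> (0 < H p) (+) (0 < H q) ->
  exists2 t : R, 0 <= t <= 1 &
    H (p.1 + t * (q.1 - p.1), p.2 + t * (q.2 - p.2)) = 0.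
Proof.
move=> cH pq.
pose L t : R := H (p.1 + t * (q.1 - p.1), p.2 + t * (q.2 - p.2)).
have cL : continuous L by apply: cts_comp => //; cts.
have L0 : L 0 = H p by rewrite /L !mul0r !addr0; case: (p).
have L1 : L 1 = H q by rewrite /L !mul1r !(addrC p.1, addrC p.2) !subrK; case: (q).
have [||t] := @IVT R L 0 1 0 ler01.
- by apply: continuous_subspaceT.
- rewrite L0 L1 ge_min le_max.
  by move: pq; case: (ltP 0 (H p)) => h1; case: (ltP 0 (H q)) => h2 //= _;
     rewrite ?(ltW h1) ?(ltW h2) ?h1 ?h2 ?orbT.
- by rewrite in_itv /= => t01 Lt; exists t.
Qed.

(** A one-dimensional degree in disguise: on a grid finer than the distance
    between [Z0] and [Z1], the number of sign changes of [H] along a column that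
    are due to [Z0] has a constant parity, which would be odd on the left side
    and even on the right side. *)
Lemma zeros_not_separated (H : R * R -> R) (x1 y0 y1 e : R)
    (Z0 Z1 : set (R * R)) :
  continuous H -> 0 < x1 -> y0 < y1 -> 0 < e ->
  (forall x, 0 <= x <= x1 -> 0 < H (x, y0)) ->
  (forall x, 0 <= x <= x1 -> H (x, y1) < 0) ->
  (forall p, H p = 0 -> 0 <= p.1 <= x1 -> y0 <= p.2 <= y1 -> Z0 p \/ Z1 p) ->
  (forall p q, Z0 p -> Z1 q -> ~ ball p e q) ->
  (forall p, Z1 p -> p.1 != 0) -> (forall p, Z0 p -> p.1 != x1) -> False.
Proof.
move=> cH x1_gt0 y01 e0 bot top cover far lft rgt.
(* A zero on an edge lies within [e / 4] of the lower left end of that edge, hence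
   within [e / 2] of the lower left corner of both adjacent cells. *)
have e4 : 0 < e / 4 by apply: divr_gt0.
have [N [N0 Nx Ny]] : exists N : nat,
    [/\ (0 < N)%N, x1 / N%:R < e / 4 & (y1 - y0) / N%:R < e / 4].
  pose w := Num.max x1 (y1 - y0).
  have w0 : 0 < w by rewrite lt_max x1_gt0.
  pose N := (Num.truncn (w / (e / 4))).+1.
  have hN : w / (e / 4) < N%:R by apply: truncnS_gt.
  have N0 : 0 < N%:R :> R by rewrite ltr0n.
  have h : w / N%:R < e / 4.
    by rewrite ltr_pdivrMr// mulrC -ltr_pdivrMr.
  exists N; split=> //; apply: le_lt_trans h; rewrite ler_pM2r ?invr_gt0//.
    by rewrite le_max lexx.
  by rewrite le_max lexx orbT.
have NR : 0 < N%:R :> R by rewrite ltr0n.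
pose X i : R := x1 * i%:R / N%:R.
pose Y j : R := y0 + (y1 - y0) * j%:R / N%:R.
pose s i j := 0 < H (X i, Y j).
pose lab i j := `[< exists2 z, Z0 z & ball (X i, Y j) (e / 2) z >].
have X0 : X 0%N = 0 by rewrite /X mulr0 mul0r.
have XN : X N = x1 by rewrite /X mulfK// gt_eqF.
have Y0 : Y 0%N = y0 by rewrite /Y mulr0 mul0r addr0.
have YN : Y N = y1 by rewrite /Y mulfK ?gt_eqF//; ring.
have XS i : X i.+1 = X i + x1 / N%:R by rewrite /X -natr1; field; rewrite gt_eqF.
have YS i : Y i.+1 = Y i + (y1 - y0) / N%:R.
  by rewrite /Y -natr1; field; rewrite gt_eqF.
have dx : 0 < x1 / N%:R by apply: divr_gt0.
have dy : 0 < (y1 - y0) / N%:R by apply: divr_gt0 => //; rewrite subr_gt0.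
have Xb i : (i <= N)%N -> 0 <= X i <= x1.
  move=> iN; rewrite /X; apply/andP; split.
    by rewrite divr_ge0// mulr_ge0// ltW.
  rewrite ler_pdivrMr// ler_pM2l// ler_nat//.
have Yb i : (i <= N)%N -> y0 <= Y i <= y1.
  move=> iN; rewrite /Y; apply/andP; split.
    by rewrite lerDl divr_ge0// mulr_ge0// subr_ge0 ltW.
  rewrite addrC -lerBrDr ler_pdivrMr// ler_pM2l ?subr_gt0// ler_nat//.
have labE i j z : H z = 0 -> 0 <= z.1 <= x1 -> y0 <= z.2 <= y1 ->
    ball (X i, Y j) (e / 2) z -> lab i j = `[< Z0 z >].
  move=> Hz z1 z2 bz; apply/asboolP/asboolP => [[z' Zz' bz']|Zz]; last by exists z.
  have [//|Z1z] := cover z Hz z1 z2.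
  case: (far _ _ Zz' Z1z).
  by rewrite [e]splitr; apply: ball_triangle bz; apply/ball_sym.
have bX i j z : X i <= z.1 <= X i + e / 4 -> Y j <= z.2 <= Y j + e / 4 ->
    ball (X i, Y j) (e / 2) z.
  move=> h1 h2; split; rewrite /ball /= ltr_norml; lra.
have vert i j : (i <= N)%N -> (j < N)%N -> s i j (+) s i j.+1 ->
    exists z, [/\ H z = 0, z.1 = X i, Y j <= z.2 <= Y j + e / 4 & y0 <= z.2 <= y1].
  move=> iN jN /(sign_change_segment cH)[t t01 /= Hz].
  eexists; split; first exact: Hz.
  - by rewrite /= subrr mulr0 addr0.
  - rewrite /= YS; set d := (y1 - y0) / N%:R in dy Ny *; nra.
  - have /andP[h1 _] := Yb j (ltnW jN); have /andP[_] := Yb j.+1 jN.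
    rewrite /= YS; set d := (y1 - y0) / N%:R in dy *; nra.
have hori i j : (i < N)%N -> s i j (+) s i.+1 j ->
    exists z, [/\ H z = 0, z.2 = Y j, X i <= z.1 <= X i + e / 4 & 0 <= z.1 <= x1].
  move=> iN /(sign_change_segment cH)[t t01 /= Hz].
  eexists; split; first exact: Hz.
  - by rewrite /= subrr mulr0 addr0.
  - rewrite /= XS; set d := x1 / N%:R in dx Nx *; nra.
  - have /andP[h1 _] := Xb i (ltnW iN); have /andP[_] := Xb i.+1 iN.
    rewrite /= XS; set d := x1 / N%:R in dx *; nra.
apply: (@grid_parity N s lab).
- by move=> i iN; rewrite /s Y0 bot// Xb.
- by move=> i iN; rewrite /s YN -leNgt ltW// top// Xb.
- move=> j jN h; have [//|z [Hz z1 z2 z2b]] := vert _ _ _ jN h.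
  rewrite (labE _ _ z)//; [|by rewrite z1 Xb|by apply: bX => //; rewrite z1; lra].
  apply/asboolP; have zb : 0 <= z.1 <= x1 by rewrite z1 Xb.
  have [//|] := cover z Hz zb z2b.
  by move=> /lft; rewrite z1 X0 eqxx.
- move=> j jN h; have [//|z [Hz z1 z2 z2b]] := vert _ _ _ jN h.
  rewrite (labE _ _ z)//; [|by rewrite z1 Xb|by apply: bX => //; rewrite z1; lra].
  by apply/asboolP => /rgt; rewrite z1 XN eqxx.
- move=> i j iN jN; exists (lab i j); split=> // h.
  + have [//|z [Hz z1 z2 z2b]] := vert _ _ _ jN h.
    have zb : 0 <= z.1 <= x1 by rewrite z1 Xb.
    rewrite (labE _ _ z)//; last by apply: bX => //; rewrite z1; lra.
    by rewrite (labE _ _ z)//; apply: bX => //; rewrite z1 XS; lra.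
  + have [//|z [Hz z2 z1 z1b]] := hori _ _ _ h.
    have zb : y0 <= z.2 <= y1 by rewrite z2 Yb.
    rewrite (labE _ _ z)//; last by apply: bX => //; rewrite z2; lra.
    by rewrite (labE _ _ z)//; apply: bX => //; rewrite z2 YS; lra.
Qed.

End Crossing.

Section EpsilonChains.
Variables (R : realType) (T : pseudoMetricType R) (Z : set T) (p0 : T).

(** Points that can be joined to [p0] by a finite chain in [Z] with steps shorter
    than [e], as the smallest set closed under such steps. *)
Definition reach (e : R) : set T := [set q | forall S : set T, S p0 ->
  (forall x y, S x -> Z y -> ball x e y -> S y) -> S q].

Lemma reach_start e : reach e p0.
Proof. by move=> S. Qed.

Lemma reach_step e x y : reach e x -> Z y -> ball x e y -> reach e y.
Proof. by move=> ex Zy xy S S0 Sn; exact: (Sn x y (ex S S0 Sn) Zy xy). Qed.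

Lemma reach_sub e : Z p0 -> reach e `<=` Z.
Proof. by move=> Z0 q h; exact: (h Z Z0 (fun _ _ _ Zy _ => Zy)). Qed.

Lemma le_reach e e' : e <= e' -> reach e `<=` reach e'.
Proof.
move=> ee' q qe S S0 Sn; apply: qe => // x y Sx Zy xy.
by apply: Sn Zy (le_ball ee' xy).
Qed.

Lemma reach_cluster (C : set T) : compact Z -> Z p0 -> closed C ->
  (forall e, 0 < e -> exists2 q, reach e q & C q) ->
  exists2 q, C q & forall e, 0 < e -> reach e q.
Proof.
move=> cZ Z0 clC ex.
pose A e : set T := reach e `&` C.
pose F := filter_from [set e : R | 0 < e] A.
have FF : ProperFilter F.
  apply: filter_from_proper; last by move=> e /ex[q]; exists q.
  apply: filter_from_filter; first by exists 1 => /=.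
  move=> a b /= a0 b0; exists (Num.min a b); first by rewrite /= lt_min a0.
  move=> q [qr qC]; split; split=> //; apply: le_reach qr;
    by rewrite ge_min lexx ?orbT.
have [q [Zq Fq]] : Z `&` cluster F !=set0.
  by apply: cZ; exists 1 => //= q [+ _]; exact: reach_sub.
exists q.
  apply: clC => U Uq; have [|x [[_ Cx] Ux]] := Fq (A 1) U _ Uq.
    by exists 1 => //=.
  by exists x.
move=> e e0.
have [||x [[xr _] qx]] := Fq (A e) (ball q e); first by exists e.
  exact: nbhsx_ballx.
by apply: reach_step xr Zq _; exact: ball_sym.
Qed.

(** In a compact set the points reachable by chains of every mesh form a
    connected set: a splitting into two closed pieces at distance [3 d] would
    be jumped over by each fine chain, and the landing points would accumulate
    at a point that is reachable but lies in neither piece. *)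
Lemma reach_component (C : set T) : compact Z -> closed Z -> Z p0 -> closed C ->
  (forall e, 0 < e -> exists2 q, reach e q & C q) ->
  exists2 q, C q & connected_component Z p0 q.
Proof.
move=> cZ clZ Z0 clC ex.
have [q Cq rq] := reach_cluster cZ Z0 clC ex.
exists q => //; pose K : set T := [set q | forall e, 0 < e -> reach e q].
suff cK : connected K.
  exists K => //; split=> //; first by move=> e _; exact: reach_start.
  by move=> x /(_ 1 ltr01); exact: reach_sub.
have KZ : K `<=` Z by move=> x /(_ 1 ltr01); exact: reach_sub.
have clK : closed K.
  move=> x clx e e0; have [y [Ky xy]] := clx _ (nbhsx_ballx x e e0).
  apply: reach_step (Ky e e0) _ (ball_sym xy).
  by apply: clZ => U /clx[z [/KZ Zz Uz]]; exists z.
apply: contrapT => /connectedPn[E [E0 KE [sE1 sE2]]].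
have clE b : closed (E b).
  move=> x clx.
  have : K x by apply: clK; apply: closure_subset clx; rewrite KE; case: b; [exact: subsetUr|exact: subsetUl].
  rewrite KE => -[] Ex; case: b clx => // clx.
    by have : set0 x by rewrite -sE2.
  by have : set0 x by rewrite -sE1.
have dE b : E b `&` E (~~ b) = set0.
  apply/seteqP; split=> // x []; case: b => /= h1 h2.
    by have : set0 x by rewrite -sE2; split=> //; exact: subset_closure.
  by have : set0 x by rewrite -sE2; split=> //; exact: subset_closure.
have KEb b x : E b x -> K x by rewrite KE; case: b => h; [right|left].
have [b Eb0] : exists b, E b p0.
  have : K p0 by move=> e _; exact: reach_start.
  by rewrite KE => -[]; [exists false|exists true].
have [q1 Eq1] := E0 (~~ b).
have cEb : compact (E b).
  by apply: (subclosed_compact (clE b) cZ) => x /KEb/KZ.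
have [d d0 dist] : exists2 d, 0 < d & forall x, E b x ->
    forall y, ball x d y -> ~ E (~~ b) y.
  have /compact_near_coveringP := cEb.
  move=> /(_ R (0^'+) (fun d x => forall y, ball x d y -> ~ E (~~ b) y) _) cov.
  have : \forall d \near 0^'+, E b `<=` (fun x => forall y, ball x d y -> ~ E (~~ b) y).
    apply: cov => x Ebx.
    have : nbhs x (~` E (~~ b)).
      apply: open_nbhs_nbhs; split; first exact: closed_openC.
      by move=> h; have : set0 x by rewrite -(dE b).
    move=> /nbhs_ballP[r /= r0 xr].
    near=> x' d => /= y xy.
    apply: xr; rewrite [r]splitr; apply: ball_triangle.
      have : ball x (r / 2) x' by near: x'; apply: nbhsx_ballx; exact: divr_gt0.
      exact.
    apply: le_ball xy; near: d; apply: nbhs_right_le; exact: divr_gt0.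
  move=> [/= r r0 cl]; exists (r / 2); first exact: divr_gt0.
  move=> x Ex; apply: (cl (r / 2)) => //=; last exact: divr_gt0.
  by rewrite sub0r normrN gtr0_norm ?divr_gt0// gtr_pMr// invf_lt1// ltr1n.
have d3 : 0 < d / 3 by apply: divr_gt0.
pose far : set T := [set y | forall x, K x -> ~ ball x (d / 3) y].
have [||y fy ry] := reach_cluster (C := closure far) cZ Z0.
- exact: closed_closure.
- move=> e e0; pose e' := Num.min e (d / 3).
  have e'0 : 0 < e' by rewrite lt_min e0.
  have [e'e e'd] : e' <= e /\ e' <= d / 3 by rewrite !ge_min !lexx orbT.
  pose S : set T := reach e' `&` [set x | exists2 a, E b a & ball a (d / 3) x].
  have [x [y [[rx [a Ea ax]] Zy xy Sy]]] :
      exists x y, [/\ S x, Z y, ball x e' y & ~ S y].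
    apply: contrapT => no.
    have [_ [a Ea aq]] : S q1.
      apply: (KEb _ _ Eq1 e' e'0 S).
        by split; [exact: reach_start|exists p0 => //; exact: ballxx].
      by move=> x y Sx Zy xy; apply: contrapT => Sy; apply: no; exists x, y.
    apply: (dist a Ea q1 _ Eq1); apply: le_ball aq.
    by rewrite ler_piMr ?ltW// invf_lt1// ltr1n.
  have ry : reach e' y := reach_step rx Zy xy.
  exists y; first exact: (le_reach e'e ry).
  apply: subset_closure => k Kk ky.
  have : (E b `|` E (~~ b)) k by move: Kk; rewrite KE => -[] h; case: (b); [right|left|left|right].
  case=> Ek; first by apply: Sy; split=> //; exists k.
  apply: (dist a Ea k) => //.
  have -> : d = d / 3 + d / 3 + d / 3 by field.
  apply: ball_triangle (ball_sym ky).
  by apply: ball_triangle ax (le_ball e'd xy).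
- have [z [fz yz]] := fy _ (nbhsx_ballx y _ d3).
  exact: fz ry yz.
Unshelve. all: by end_near. Qed.

End EpsilonChains.

Lemma zero_continuum (R : realType) (H : R * R -> R) (x1 y0 y1 : R) (p0 : R * R) :
  continuous H -> 0 < x1 -> y0 < y1 ->
  (forall x, 0 <= x <= x1 -> 0 < H (x, y0)) ->
  (forall x, 0 <= x <= x1 -> H (x, y1) < 0) ->
  let Z := [set p | [/\ H p = 0, 0 <= p.1 <= x1 & y0 <= p.2 <= y1]] in
  Z p0 -> (forall p, Z p -> p.1 = 0 -> p = p0) -> p0.1 = 0 ->
  exists2 q, q.1 = x1 & connected_component Z p0 q.
Proof.
move=> cH x1_gt0 y01 bot top Z Zp0 uniq0 p01.
have cp1 : continuous (fun p : R * R => p.1) by cts.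
have cp2 : continuous (fun p : R * R => p.2) by cts.
have ZE : Z = H @^-1` [set 0] `&` (`[0, x1] `*` `[y0, y1]).
  apply/seteqP; split=> p /=; rewrite !in_itv /=; first by case.
  by case=> ? [].
have clH : closed (H @^-1` [set 0]).
  by apply: closed_comp; [move=> x _; exact: cH|exact: closed_eq].
have cZ : compact Z.
  rewrite ZE setIC; apply: compact_closedI => //.
  by apply: compact_setX; exact: segment_compact.
have clZ : closed Z.
  rewrite ZE; apply: closedI => //.
  have -> : `[0, x1]%classic `*` `[y0, y1]%classic =
      (fun p : R * R => p.1) @^-1` `[0, x1] `&` (fun p => p.2) @^-1` `[y0, y1].
    by [].
  apply: closedI; apply: closed_comp; try exact: interval_closed.
    by move=> x _; exact: cp1.
  by move=> x _; exact: cp2.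
apply: (@reach_component _ _ Z p0 [set q | q.1 = x1] cZ clZ Zp0).
  have -> : [set q : R * R | q.1 = x1] = (fun p => p.1) @^-1` [set x1] by [].
  by apply: closed_comp; [move=> x _; exact: cp1|exact: closed_eq].
move=> e e0; apply: contrapT => no.
apply: (@zeros_not_separated R H x1 y0 y1 e (reach Z p0 e)
  (Z `\` reach Z p0 e)) => //.
- move=> p Hp p1 p2; case: (pselect (reach Z p0 e p)) => h; first by left.
  by right; split.
- by move=> p q rp [Zq rq] pq; apply: rq; exact: reach_step rp Zq pq.
- move=> p [Zp rp]; apply/eqP => p1; apply: rp.
  by rewrite (uniq0 p Zp p1); exact: reach_start.
- by move=> p rp; apply/eqP => p1; apply: no; exists p.
Qed.

(** * Primitives of functions with parameters *)

Section Primitives.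
Variable R : realType.
Implicit Types f g F G : R -> R.

Lemma is_derive_cts F (dF : R -> R) :
  (forall x : R, is_derive x 1 F (dF x)) -> continuous F.
Proof.
by move=> h x; apply: differentiable_continuous; apply/derivable1_diffP; case: (h x).
Qed.

Lemma mvt_le F (dF : R -> R) G (dG : R -> R) a b : a <= b ->
  (forall x : R, is_derive x 1 F (dF x)) -> (forall x : R, is_derive x 1 G (dG x)) ->
  (forall x : R, a <= x <= b -> dF x <= dG x) -> F b - F a <= G b - G a.
Proof.
rewrite le_eqVlt => /predU1P[->|ab] hF hG h; first by rewrite !subrr.
have hGF (x : R) : is_derive x 1 (G - F) (dG x - dF x) by apply: is_deriveB.
have [|c] := @MVT R (G - F) (fun x => dG x - dF x) a b ab (fun x _ => hGF x).
  by apply: continuous_subspaceT; exact: is_derive_cts hGF.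
rewrite in_itv /= => /andP[ac cb] E.
have : 0 <= (G - F) b - (G - F) a.
  by rewrite E mulr_ge0 ?subr_ge0 ?h ?ltW//; rewrite !ltW.
by rewrite /= !fctE; lra.
Qed.

Lemma mvt_eq F G (df : R -> R) a b :
  (forall x : R, is_derive x 1 F (df x)) -> (forall x : R, is_derive x 1 G (df x)) ->
  F b - F a = G b - G a.
Proof.
move=> hF hG.
have main u v : u <= v -> F v - F u = G v - G u.
  by move=> uv; apply/le_anti; rewrite !(@mvt_le _ df _ df).
by have [/main//|/ltW/main] := leP a b; lra.
Qed.

(** The integral from a base point has derivative [f] to the right of the base
    point only; letting the base point move to the left with [x] removes the
    restriction, since the primitives that vanish at [0] agree where both are
    defined. *)
Lemma exists_primitive f : continuous f ->
  exists F, F 0 = 0 /\ forall x : R, is_derive x 1 F (f x).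
Proof.
move=> cf.
pose G (a x : R) := (\int[@lebesgue_measure R]_(t in [set` Interval (BLeft a) (BRight x)]) f t)%R.
have dG (a x : R) : a < x -> is_derive x 1 (G a) (f x).
  move=> ax; have xx : x < x + 1 by rewrite ltrDl.
  have fi : (@lebesgue_measure R).-integrable [set` Interval (BLeft a) (BRight (x + 1))]
      (EFin \o f).
    apply: continuous_compact_integrable; first exact: segment_compact.
    exact: continuous_subspaceT.
  have [|d E] := @continuous_FTC1 R f (BLeft a) x (x + 1) xx fi _ (cf x).
    by rewrite lte_fin.
  by apply: DeriveDef; [exact: d|rewrite -derive1E; exact: E].
have GG a b x : a < b -> b < 0 -> b < x -> G a x - G a 0 = G b x - G b 0.
  move=> ab b0 bx.
  have main u v : b < u -> u < v -> G a v - G a u = G b v - G b u.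
    move=> bu uv.
    have d0 y : y \in `]u, v[ -> is_derive (y : R) 1 (G a - G b) 0.
      rewrite in_itv /= => /andP[uy _].
      have -> : 0 = f y - f y by rewrite subrr.
      by apply: is_deriveB; apply: dG; lra.
    have [|c _] := @MVT R (G a - G b) (fun _ => 0) u v uv d0.
    - apply: derivable_within_continuous => y; rewrite in_itv /= => /andP[uy _].
      have [ay by0] : a < y /\ b < y by split; lra.
      by apply: derivableB; [case: (dG a y ay)|case: (dG b y by0)].
    by rewrite mul0r !fctE; lra.
  have [x0|x0|->] := ltgtP x 0; last by lra.
    by have := main _ _ bx x0; lra.
  by have := main _ _ b0 x0; lra.
exists (fun x => G (- (`|x| + 1)) x - G (- (`|x| + 1)) 0).
split; first by rewrite subrr.
move=> x; pose a := - (`|x| + 2).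
have xa : a < x by rewrite /a; have := ler_norm (- x); rewrite normrN; lra.
have : is_derive x 1 (fun y => G a y - G a 0) (f x).
  have -> : f x = f x - 0 by rewrite subr0.
  by apply: is_deriveB; exact: dG.
apply: near_eq_is_derive.
near=> y.
have yx : `|y| < `|x| + 1.
  near: y; apply: (cvgr_lt `|x|); last by rewrite ltrDl.
  exact: norm_continuous.
by apply: GG; rewrite /a; have := ler_norm (- y); have := normr_ge0 y;
  rewrite normrN; lra.
Unshelve. all: by end_near. Qed.


(** The primitive of [f] vanishing at [0]; it is only ever characterised by
    [primP], so that estimates on integrals become instances of the mean value
    theorem. *)
Definition prim f : R -> R :=
  xget (fun _ => 0) [set F | F 0 = 0 /\ forall x : R, is_derive x 1 F (f x)].

Lemma primP f : continuous f ->
  prim f 0 = 0 /\ forall x : R, is_derive x 1 (prim f) (f x).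
Proof.
move=> cf; have [F hF] := exists_primitive cf.
by rewrite /prim; case: xgetP => [G _ //|/(_ F)]; case.
Qed.

Lemma prim0 f : continuous f -> prim f 0 = 0.
Proof. by move=> /primP[]. Qed.

Lemma prim_derive f (x : R) : continuous f -> is_derive x 1 (prim f) (f x).
Proof. by move=> /primP[]. Qed.

Lemma primE f F a : continuous f -> (forall x : R, is_derive x 1 F (f x)) ->
  prim f a = F a - F 0.
Proof.
move=> cf hF; have -> : prim f a = prim f a - prim f 0 by rewrite prim0// subr0.
by apply: (@mvt_eq _ _ f) => // x; exact: prim_derive.
Qed.

Lemma prim_le f g a b : continuous f -> continuous g -> a <= b ->
  (forall x, a <= x <= b -> f x <= g x) -> prim f b - prim f a <= prim g b - prim g a.
Proof. by move=> cf cg ab; apply: mvt_le => // x; exact: prim_derive. Qed.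

Lemma prim_le_from0 f g a : continuous f -> continuous g -> 0 <= a ->
  (forall x, 0 <= x <= a -> f x <= g x) -> prim f a <= prim g a.
Proof.
move=> cf cg a0 h; have := prim_le cf cg a0 h.
by rewrite !prim0// !subr0.
Qed.

Lemma prim_cst c a : prim (fun _ => c) a = c * a.
Proof.
have h (x : R) : is_derive x 1 (c *: (id : R -> R)) c.
  by rewrite -[c in X in is_derive _ _ _ X]mulr1; exact: is_deriveZ.
rewrite (primE a _ h); last exact: cts_cst.
by rewrite !fctE /GRing.scale /= mulr0 subr0.
Qed.

Lemma primD f g a : continuous f -> continuous g ->
  prim (fun x => f x + g x) a = prim f a + prim g a.
Proof.
move=> cf cg.
have h (x : R) : is_derive x 1 (prim f + prim g) (f x + g x).
  by apply: is_deriveD; exact: prim_derive.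
rewrite (primE a _ h); last exact: cts_add.
by rewrite !fctE !prim0// addr0 subr0.
Qed.

Lemma primZ c f a : continuous f -> prim (fun x => c * f x) a = c * prim f a.
Proof.
move=> cf.
have h (x : R) : is_derive x 1 (c *: prim f) (c * f x).
  by apply: is_deriveZ; exact: prim_derive.
rewrite (primE a _ h); last by apply: cts_mul => //; exact: cts_cst.
by rewrite !fctE !prim0// /GRing.scale /= mulr0 subr0.
Qed.

End Primitives.

Section ParametricPrimitives.
Variables (R : realType) (T : topologicalType).

(** Tube lemma, in the form in which it yields uniform convergence. *)
Lemma near_uniform (V : pseudoMetricType R) (f : T -> R -> V) (p : T) (M e : R) :
  continuous (fun x : T * R => f x.1 x.2) -> 0 < e ->
  \forall q \near p, forall u, `|u| <= M -> ball (f p u) e (f q u).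
Proof.
move=> cf e0.
have /compact_near_coveringP := @segment_compact R (- M) M.
move=> /(_ T (nbhs p) (fun q u => ball (f p u) e (f q u)) _) cov.
have : \forall q \near p, `[- M, M] `<=` (fun u => ball (f p u) e (f q u)).
  apply: cov => u _.
  have e2 : 0 < e / 2 by apply: divr_gt0.
  have : \forall x \near (p, u), ball (f p u) (e / 2) (f x.1 x.2).
    by apply: (cf (p, u)); exact: nbhsx_ballx.
  move=> [[A B] /= [Ap Bu] AB].
  exists (B, A) => //= -[v q] [/= Bv Aq].
  rewrite [e]splitr; apply: (@ball_triangle _ _ (f p u)).
    by apply/ball_sym; apply: (AB (p, v)); split => //; exact: nbhs_singleton.
  exact: (AB (q, v)).
apply: filterS => q h u uM; apply: h.
by rewrite /= in_itv /= -ler_norml.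
Qed.

Lemma cts_prim (f : T -> R -> R) : continuous (fun x : T * R => f x.1 x.2) ->
  continuous (fun x : T * R => prim (f x.1) x.2).
Proof.
move=> cf.
have cq q : continuous (f q).
  by apply: (@cts_comp _ _ _ (fun x : T * R => f x.1 x.2) (fun u => (q, u))) => //; cts.
move=> [p t]; apply/cvgrPdist_lt => e e0.
pose M := `|t| + 1; have M0 : 0 < M by rewrite /M; have := normr_ge0 t; lra.
have eM : 0 < e / (4 * M) by apply: divr_gt0 => //; apply: mulr_gt0.
have nu := near_uniform p M cf eM.
have nt : \forall u \near t, `|u| < M /\ `|prim (f p) t - prim (f p) u| < e / 2.
  near=> u; split.
    near: u; apply: (cvgr_lt `|t|); last by rewrite /M ltrDl.
    exact: norm_continuous.
  near: u; have ct : {for t, continuous (prim (f p))}.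
    by apply: is_derive_cts => x; exact: prim_derive.
  by move/cvgrPdist_lt : ct; apply; apply: divr_gt0.
exists ([set q | forall u, `|u| <= M -> ball (f p u) (e / (4 * M)) (f q u)],
        [set u | `|u| < M /\ `|prim (f p) t - prim (f p) u| < e / 2]) => //=.
move=> [q u] [/= hq [uM pu]].
have bnd s : `|s| <= M -> - (e / (4 * M)) <= f q s - f p s <= e / (4 * M).
  move=> /hq /ltW; rewrite ler_norml; lra.
have D s : prim (fun x => f q x - f p x) s = prim (f q) s - prim (f p) s.
  have cN : continuous (fun x => - 1 * f p x) by cts.
  have -> : (fun x => f q x - f p x) = (fun x => f q x + - 1 * f p x).
    by apply/funext => x; rewrite mulN1r.
  by rewrite primD// primZ// mulN1r.
have cdiff : continuous (fun x => f q x - f p x) by apply: cts_add => //; apply: cts_opp.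
have d0 : prim (fun x => f q x - f p x) 0 = 0 by exact: prim0.
have : `|prim (f q) u - prim (f p) u| <= e / (4 * M) * M.
  rewrite -D.
  have main a b : a <= b -> `|a| <= M -> `|b| <= M ->
      `|prim (fun x => f q x - f p x) b - prim (fun x => f q x - f p x) a|
        <= e / (4 * M) * (b - a).
    move=> ab aM bM.
    have xM x : a <= x <= b -> `|x| <= M.
      by move: aM bM; rewrite !ler_norml; lra.
    have c1 : continuous (fun _ : R => e / (4 * M)) by exact: cts_cst.
    have c2 : continuous (fun _ : R => - (e / (4 * M))) by exact: cts_cst.
    have := prim_le cdiff c1 ab; have := prim_le c2 cdiff ab.
    rewrite !prim_cst => h1 h2.
    have {}h1 := h1 (fun x xab => proj1 (andP (bnd x (xM x xab)))).
    have {}h2 := h2 (fun x xab => proj2 (andP (bnd x (xM x xab)))).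
    by rewrite ler_norml; lra.
  have M0' : `|0 : R| <= M by rewrite normr0 ltW.
  have uM' := ltW uM.
  have um : `|u| <= M := uM'.
  move: um; rewrite ler_norml => /andP[u1 u2].
  have [u0|/ltW u0] := leP 0 u.
    have := main _ _ u0 M0' uM'; rewrite d0 subr0 => /le_trans; apply.
    by rewrite ler_pM2l// subr0.
  have := main _ _ u0 uM' M0'; rewrite d0 sub0r normrN => /le_trans; apply.
  by rewrite ler_pM2l//; lra.
have -> : e / (4 * M) * M = e / 4 by field; rewrite gt_eqF.
move: pu; rewrite ltr_norml ler_norml ltr_norml; lra.
Unshelve. all: by end_near. Qed.

End ParametricPrimitives.

(** * Derivation rules *)

Section DerivationRules.
Variable R : realType.
Implicit Types (f g : R -> R) (x a b : R).

(** [is_derive] in direction [1], as a plain proposition rather than a class, so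
    that the rules below can be chained by unification. *)
Definition der f x a : Prop := is_derive x 1 f a.

Lemma der_eq f x a b : der f x a -> a = b -> der f x b.
Proof. by move=> h <-. Qed.

Lemma der_near f g x a : (\forall y \near x, f y = g y) -> der f x a -> der g x a.
Proof. exact: near_eq_is_derive. Qed.

Lemma der_cst x b : der (fun _ => b) x 0.
Proof. exact: is_derive_cst. Qed.

Lemma der_id x : der (fun y => y) x 1.
Proof. exact: is_derive_id. Qed.

Lemma der_add f g x a b : der f x a -> der g x b -> der (fun y => f y + g y) x (a + b).
Proof. exact: is_deriveD. Qed.

Lemma der_opp f x a : der f x a -> der (fun y => - f y) x (- a).
Proof. exact: is_deriveN. Qed.

Lemma der_mul f g x a b : der f x a -> der g x b ->
  der (fun y => f y * g y) x (a * g x + f x * b).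
Proof.
move=> df dg.
have := @is_deriveM R R f g x 1 a b df dg.
by rewrite /der /GRing.scale /= addrC mulrC [in X in _ + X]mulrC mulrC (mulrC b) (mulrC a).
Qed.

Lemma der_exp f n x a : der f x a ->
  der (fun y => f y ^+ n) x (n%:R * f x ^+ n.-1 * a).
Proof.
move=> df; elim: n => [|n IH].
  by rewrite mul0r mul0r; under [X in der X]eq_fun do rewrite expr0; exact: der_cst.
under [X in der X]eq_fun do rewrite exprS.
apply: der_eq (der_mul df IH) _ => /=.
case: n {IH} => [|n]; first by rewrite expr0; ring.
by rewrite /= exprS -!natr1; ring.
Qed.

Lemma der_comp f g x a b : der f (g x) a -> der g x b -> der (fun y => f (g y)) x (a * b).
Proof. exact: is_derive1_comp. Qed.

Lemma der_inv f x a : f x != 0 -> der f x a ->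
  der (fun y => (f y)^-1) x (- a / f x ^+ 2).
Proof.
move=> f0 df; apply: der_eq (is_deriveV f0 df) _.
by rewrite /GRing.scale /=; field.
Qed.

Lemma der_cos f x a : der f x a -> der (fun y => cos (f y)) x (- sin (f x) * a).
Proof. by apply: der_comp; exact: is_derive_cos. Qed.

Lemma der_sin f x a : der f x a -> der (fun y => sin (f y)) x (cos (f x) * a).
Proof. by apply: der_comp; exact: is_derive_sin. Qed.

Lemma der_ln f x a : 0 < f x -> der f x a -> der (fun y => ln (f y)) x ((f x)^-1 * a).
Proof. by move=> f0; apply: der_comp; exact: is_derive1_ln. Qed.

Lemma der_sqrt f x a : 0 < f x -> der f x a ->
  der (fun y => Num.sqrt (f y)) x ((2 * Num.sqrt (f x))^-1 * a).
Proof. by move=> f0; apply: der_comp; exact: is_derive1_sqrt. Qed.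

End DerivationRules.

Ltac der :=
  try match goal with H : der ?f ?x _ |- der ?f ?x _ => exact: H end;
  lazymatch goal with
  | |- der (fun y => y) _ _ => apply: der_id
  | |- der (fun _ => ?c) _ _ => apply: der_cst
  | |- der (fun y => @GRing.add _ _ _) _ _ => apply: der_add; der
  | |- der (fun y => @Algebra.add _ _ _) _ _ => apply: der_add; der
  | |- der (fun y => @GRing.opp _ _) _ _ => apply: der_opp; der
  | |- der (fun y => @Algebra.opp _ _) _ _ => apply: der_opp; der
  | |- der (fun y => @GRing.mul _ _ _) _ _ => apply: der_mul; der
  | |- der (fun y => @GRing.inv _ _) _ _ => apply: der_inv; der
  | |- der (fun y => @GRing.exp _ _ _) _ _ => apply: der_exp; der
  | |- der (fun y => cos _) _ _ => apply: der_cos; der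
  | |- der (fun y => sin _) _ _ => apply: der_sin; der
  | |- der (fun y => ln _) _ _ => apply: der_ln; der
  | |- der (fun y => Num.sqrt _) _ _ => apply: der_sqrt; der
  | |- der (@GRing.mul _ ?b) ?x _ =>
      apply: (@der_mul _ (fun _ => b) (fun y => y) x); der
  | |- der cos _ _ => exact: is_derive_cos
  | |- der sin _ _ => exact: is_derive_sin
  | |- _ => idtac
  end.

(** * Symmetries of primitives, and inverses with parameters *)

Section PrimitiveSymmetry.
Variable R : realType.
Implicit Types (f : R -> R) (x T : R).

Lemma prim_even f x : continuous f -> (forall x, f (- x) = f x) ->
  prim f (- x) = - prim f x.
Proof.
move=> cf fN.
have h (u : R) : der (fun y => - prim f (- y)) u (f u).
  apply: der_eq; first apply: der_opp.
    by apply: der_comp; [exact: prim_derive|apply: der_opp; exact: der_id].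
  by rewrite fN; ring.
by rewrite (primE (- x) cf h) opprK oppr0 prim0//; ring.
Qed.

Lemma prim_periodic f T x : continuous f -> (forall x, f (x + T) = f x) ->
  prim f (x + T) = prim f x + prim f T.
Proof.
move=> cf fT.
have h (u : R) : der (fun y => prim f (y + T)) u (f u).
  apply: der_eq.
    by apply: der_comp; [exact: prim_derive|apply: der_add; [exact: der_id|exact: der_cst]].
  by rewrite fT; ring.
by rewrite (primE x cf h) add0r; ring.
Qed.

Lemma prim_lt f a b : continuous f -> (forall x, 0 < f x) -> a < b -> prim f a < prim f b.
Proof.
move=> cf f0 ab.
have [|c _ E] := @MVT R (prim f) f a b ab (fun x _ => prim_derive x cf).
  by apply: continuous_subspaceT; apply: is_derive_cts => x; exact: prim_derive.
by rewrite -subr_gt0 E mulr_gt0// subr_gt0.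
Qed.

End PrimitiveSymmetry.

Section Inverse.
Variables (R : realType) (T : topologicalType) (f g : T -> R -> R).
Hypothesis cf : continuous (fun x : T * R => f x.1 x.2).
Hypothesis f_incr : forall p x y, x < y -> f p x < f p y.
Hypothesis fgK : forall p z, f p (g p z) = z.

Lemma incr_lt p x y : (f p x < f p y) = (x < y).
Proof.
apply/idP/idP => [|/f_incr//]; apply: contraTT; rewrite -!leNgt le_eqVlt.
by move=> /predU1P[->//|/(f_incr p)/ltW].
Qed.

Lemma incr_inj p x y : f p x = f p y -> x = y.
Proof. by move=> h; apply/le_anti; rewrite !leNgt -(incr_lt p y x) -(incr_lt p x y) h ltxx. Qed.

Lemma gfK p x : g p (f p x) = x.
Proof. by apply: (@incr_inj p); rewrite fgK. Qed.

Lemma cts_inverse : continuous (fun x : T * R => g x.1 x.2).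
Proof.
move=> [p z]; apply/cvgrPdist_lt => e e0.
have lo : f p (g p z - e) < z by rewrite -{2}(fgK p z) f_incr// ltrBlDr ltrDl.
have hi : z < f p (g p z + e) by rewrite -{1}(fgK p z) f_incr// ltrDl.
have cp a : {for p, continuous (fun q => f q a)}.
  by apply: (@cts_comp _ _ _ (fun x : T * R => f x.1 x.2) (fun q => (q, a))) => //; cts.
have nlo : \forall q \near p, f q (g p z - e) < (f p (g p z - e) + z) / 2.
  by apply: (cvgr_lt _ (cp _)); lra.
have nhi : \forall q \near p, (f p (g p z + e) + z) / 2 < f q (g p z + e).
  by apply: (cvgr_gt _ (cp _)); lra.
have zlo : \forall w \near z, (f p (g p z - e) + z) / 2 < w.
  by apply: lt_nbhsr; lra.
have zhi : \forall w \near z, w < (f p (g p z + e) + z) / 2.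
  by apply: lt_nbhsl; lra.
exists ([set q | f q (g p z - e) < (f p (g p z - e) + z) / 2] `&`
        [set q | (f p (g p z + e) + z) / 2 < f q (g p z + e)],
        [set w | (f p (g p z - e) + z) / 2 < w] `&`
        [set w | w < (f p (g p z + e) + z) / 2]) => /=.
  by split; [exact: (@filterI _ (nbhs p))|exact: (@filterI _ (nbhs z))].
move=> [q w] [/= [h1 h2] [h3 h4]].
have : g p z - e < g q w by rewrite -(incr_lt q) fgK; exact: lt_trans h3.
have : g q w < g p z + e by rewrite -(incr_lt q) fgK; exact: lt_trans h4 h2.
by rewrite ltr_norml; lra.
Qed.

Lemma der_inverse p (df : R -> R) z : (forall x, der (f p) x (df x)) ->
  (forall x, df x != 0) -> der (g p) z (df (g p z))^-1.
Proof.
move=> hf df0; rewrite -{1}(fgK p z).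
apply: (@is_derive_inverse _ (f p)) => //.
- by near=> x; exact: gfK.
- have c : continuous (f p) := is_derive_cts hf.
  by near=> x; exact: c.
- exact: hf.
Unshelve. all: by end_near. Qed.

End Inverse.

(** * The normalised radial speed *)

Section Profile.
Variable R : realType.
Implicit Types q y z : R.

(** The hyperbolic cosine and the exponential of [arcsinh y]. *)
Definition kap (y : R) : R := Num.sqrt (1 + y ^+ 2).
Definition rho (y : R) : R := y + kap y.

Lemma kap_sqr y : kap y ^+ 2 = 1 + y ^+ 2.
Proof. by rewrite sqr_sqrtr// addr_ge0// sqr_ge0. Qed.

Lemma kap_ge1 y : 1 <= kap y.
Proof. by rewrite -sqrtr1 ler_wsqrtr// lerDl sqr_ge0. Qed.

Lemma kap_gt0 y : 0 < kap y.
Proof. exact: lt_le_trans ltr01 (kap_ge1 y). Qed.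

Lemma kap_gt y : `|y| < kap y.
Proof.
rewrite -(ltr_pXn2r (n := 2))// ?nnegrE// ?(ltW (kap_gt0 y))//.
by rewrite kap_sqr real_normK ?num_real// ltrDr.
Qed.

Lemma rho_gt0 y : 0 < rho y.
Proof. by have := kap_gt y; rewrite ltr_norml /rho; lra. Qed.

Lemma rhoV y : (rho y)^-1 = kap y - y.
Proof.
have r0 : rho y != 0 by rewrite gt_eqF ?rho_gt0.
apply: (mulfI r0); rewrite mulfV// /rho.
by have := kap_sqr y; lra.
Qed.

Lemma le_kap y z : `|y| <= z -> kap y <= kap z.
Proof.
move=> yz; rewrite ler_wsqrtr// lerD2l -(real_normK (num_real y)) ler_pXn2r// nnegrE//.
exact: le_trans yz.
Qed.

Lemma kapN y : kap (- y) = kap y.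
Proof. by rewrite /kap sqrrN. Qed.

Lemma tanh_incr y z : y <= z -> y * kap z <= z * kap y.
Proof.
move=> yz.
have ky := kap_gt0 y; have kz := kap_gt0 z.
have [y0|y0] := leP 0 y; have [z0|z0] := leP 0 z; last 2 first.
- by apply: (@le_trans _ _ 0); [rewrite pmulr_lle0// ltW|rewrite mulr_ge0// ltW].
- rewrite -lerN2 -!mulNr.
  rewrite -(ler_pXn2r (n := 2))// ?nnegrE ?mulr_ge0 ?oppr_ge0 ?(ltW y0) ?(ltW z0) ?(ltW ky) ?(ltW kz)//.
  by rewrite !exprMn !sqrrN !kap_sqr; nra.
- rewrite -(ler_pXn2r (n := 2))// ?nnegrE ?mulr_ge0 ?(ltW ky) ?(ltW kz)//.
  by rewrite !exprMn !kap_sqr; nra.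
- by lra.
Qed.

(** In the variable [t = y / kap y] this is [t / (1 - (1 - q) t^2)], which explains
    why it increases when [0 <= q <= 1]. *)
Definition frac (q y : R) : R := y * kap y / (1 + y ^+ 2 * q).

Lemma frac_den q y : 0 <= q -> 0 < 1 + y ^+ 2 * q.
Proof. by move=> q0; rewrite ltr_pwDl// mulr_ge0// sqr_ge0. Qed.

Lemma frac_diff q y z : 0 <= q -> frac q z - frac q y =
  (z * kap y - y * kap z) * (kap z * kap y - (1 - q) * (- (y * z))) /
  ((1 + z ^+ 2 * q) * (1 + y ^+ 2 * q)).
Proof.
move=> q0; have dy : 0 < 1 + y ^+ 2 * q := frac_den _ q0; have dz : 0 < 1 + z ^+ 2 * q := frac_den _ q0.
have ky := kap_sqr y; have kz := kap_sqr z.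
have numE : z * kap z * (1 + y ^+ 2 * q) - y * kap y * (1 + z ^+ 2 * q) =
  (z * kap y - y * kap z) * (kap z * kap y - (1 - q) * (- (y * z))).
  have -> : (z * kap y - y * kap z) * (kap z * kap y - (1 - q) * (- (y * z))) =
    z * kap z * (kap y ^+ 2) - y * kap y * (kap z ^+ 2)
    + (1 - q) * (y * z ^+ 2 * kap y - y ^+ 2 * z * kap z) by ring.
  by rewrite ky kz; ring.
rewrite -numE /frac; field.
by rewrite !lt0r_neq0.
Qed.

Lemma frac_incr q y z : 0 <= q <= 1 -> y <= z -> frac q y <= frac q z.
Proof.
move=> /andP[q0 q1] yz; rewrite -subr_ge0 frac_diff//.
have dy : 0 < 1 + y ^+ 2 * q := frac_den _ q0; have dz : 0 < 1 + z ^+ 2 * q := frac_den _ q0.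
apply: divr_ge0; last by rewrite mulr_ge0// ltW.
apply: mulr_ge0; first by rewrite subr_ge0 tanh_incr.
have := kap_gt y; have := kap_gt z; rewrite !ltr_norml => hz hy.
have : - (kap z * kap y) <= y * z.
  have := kap_gt0 y; have := kap_gt0 z; nra.
have : y * z <= kap z * kap y.
  have := kap_gt0 y; have := kap_gt0 z; nra.
nra.
Qed.

Lemma frac_lip q y z : 0 <= q <= 1 -> 0 <= y <= z ->
  frac q z - frac q y <= 2 * kap z ^+ 3 * (z - y).
Proof.
move=> /andP[q0 q1] /andP[y0 yz]; rewrite frac_diff//.
have dy : 0 < 1 + y ^+ 2 * q := frac_den _ q0; have dz : 0 < 1 + z ^+ 2 * q := frac_den _ q0.
have k1 := kap_ge1 y; have kyz : kap y <= kap z by apply: le_kap; rewrite ger0_norm.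
rewrite ler_pdivrMr; last exact: mulr_gt0.
have z0 : 0 <= z by lra.
have h1 : z * kap y - y * kap z <= (z - y) * kap z by nra.
have h0 : 0 <= z * kap y - y * kap z by rewrite subr_ge0 tanh_incr.
have yk : y < kap y by have := kap_gt y; rewrite ger0_norm.
have zk : z < kap z by have := kap_gt z; rewrite ger0_norm.
have h2 : kap z * kap y - (1 - q) * (- (y * z)) <= 2 * kap z ^+ 2.
  have : y * z <= kap z ^+ 2 by rewrite expr2; apply: ler_pM => //; lra.
  have : kap z * kap y <= kap z ^+ 2 by rewrite expr2; apply: ler_pM => //; lra.
  have : 0 <= q * (y * z) by rewrite !mulr_ge0.
  lra.
have h3 : 0 <= kap z * kap y - (1 - q) * (- (y * z)).
  have : 0 <= y * z by apply: mulr_ge0.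
  have : 0 <= kap z * kap y by apply: mulr_ge0; lra.
  nra.
have h4 : 1 <= (1 + z ^+ 2 * q) * (1 + y ^+ 2 * q).
  have : 0 <= z ^+ 2 * q by rewrite mulr_ge0// sqr_ge0.
  have : 0 <= y ^+ 2 * q by rewrite mulr_ge0// sqr_ge0.
  nra.
have h5 : (z * kap y - y * kap z) * (kap z * kap y - (1 - q) * (- (y * z))) <=
   2 * kap z ^+ 3 * (z - y).
  apply: le_trans (ler_pM h0 h3 h1 h2) _.
  by rewrite [leLHS](_ : _ = 2 * kap z ^+ 3 * (z - y))//; ring.
apply: le_trans h5 _.
rewrite ler_peMr// mulr_ge0 ?subr_ge0//.
by rewrite mulr_ge0// exprn_ge0//; lra.
Qed.

End Profile.
Arguments kap {R} y.
Arguments rho {R} y.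

Section Apsidal.
Variable R : realType.
Implicit Types q s y z u : R.

Lemma cts_kap (T : topologicalType) (f : T -> R) : continuous f ->
  continuous (fun x => kap (f x)).
Proof. by move=> cf; rewrite /kap; cts. Qed.

Lemma den_neq0 s q : 0 <= q -> 1 + s ^+ 2 * q != 0.
Proof. by move=> q0; rewrite gt_eqF// frac_den. Qed.

Lemma cts_den (T : topologicalType) (f g : T -> R) : continuous f -> continuous g ->
  continuous (fun x => (1 + f x ^+ 2 * cos (g x) ^+ 2)^-1).
Proof.
by move=> cf cg; apply: cts_inv; [move=> x; rewrite den_neq0 ?sqr_ge0|cts].
Qed.

(** The function [arcsinh s / (s * kap s)] (see [asinhqE]), written as an integral
    without singularity at [s = 0]. *)
Definition asinhq s : R := prim (fun u => cos u / (1 + s ^+ 2 * cos u ^+ 2)) (pi / 2).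

(** Up to the factor [- y * kap y], the divided difference of [asinhq] between
    [y] and [s], seen as a function of the square of its argument (see
    [tilt_diff]); the integral is regular on the diagonal, and it increases with
    [y] because its integrand does. *)
Definition tilt s y : R := prim (fun u =>
  cos u ^+ 3 / (1 + s ^+ 2 * cos u ^+ 2) * frac (cos u ^+ 2) y) (pi / 2).

Lemma cts_asinhq_integrand (T : topologicalType) (f g : T -> R) :
  continuous f -> continuous g ->
  continuous (fun x => cos (g x) / (1 + f x ^+ 2 * cos (g x) ^+ 2)).
Proof. by move=> cf cg; apply: cts_mul; [cts|exact: cts_den]. Qed.

Lemma cts_tilt_integrand (T : topologicalType) (f g h : T -> R) :
  continuous f -> continuous g -> continuous h ->
  continuous (fun x => cos (g x) ^+ 3 / (1 + f x ^+ 2 * cos (g x) ^+ 2) *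
    frac (cos (g x) ^+ 2) (h x)).
Proof.
move=> cf cg ch; rewrite /frac; apply: cts_mul.
  by apply: cts_mul; [cts|exact: cts_den].
by apply: cts_mul; [apply: cts_mul => //; exact: cts_kap|exact: cts_den].
Qed.

Lemma cts_asinhq (T : topologicalType) (f : T -> R) : continuous f ->
  continuous (fun x => asinhq (f x)).
Proof.
move=> cf.
apply: (@cts_comp _ _ _ (fun x : T * R => prim (fun u =>
  cos u / (1 + f x.1 ^+ 2 * cos u ^+ 2)) x.2) (fun x => (x, pi / 2))); last by cts.
apply: (@cts_prim R T (fun x u => cos u / (1 + f x ^+ 2 * cos u ^+ 2))).
apply: cts_asinhq_integrand; last by cts.
by apply: cts_comp => //; cts.
Qed.

Lemma cts_tilt (T : topologicalType) (f g : T -> R) : continuous f -> continuous g ->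
  continuous (fun x => tilt (f x) (g x)).
Proof.
move=> cf cg.
apply: (@cts_comp _ _ _ (fun x : T * R => prim (fun u =>
  cos u ^+ 3 / (1 + f x.1 ^+ 2 * cos u ^+ 2) * frac (cos u ^+ 2) (g x.1)) x.2)
  (fun x => (x, pi / 2))); last by cts.
apply: (@cts_prim R T (fun x u => cos u ^+ 3 / (1 + f x ^+ 2 * cos u ^+ 2) *
  frac (cos u ^+ 2) (g x))).
apply: cts_tilt_integrand; last by apply: cts_comp => //; cts.
  by apply: cts_comp => //; cts.
by cts.
Qed.

Let ipt s y : continuous (fun u =>
  cos u ^+ 3 / (1 + s ^+ 2 * cos u ^+ 2) * frac (cos u ^+ 2) y).
Proof. by apply: cts_tilt_integrand; cts. Qed.

Let ipn s : continuous (fun u => cos u / (1 + s ^+ 2 * cos u ^+ 2)).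
Proof. by apply: cts_asinhq_integrand; cts. Qed.

Lemma prim_cos : prim (cos : R -> R) (pi / 2) = 1.
Proof.
rewrite (primE (pi / 2) (@continuous_cos R) (@is_derive_sin R)).
by rewrite sin_pihalf sin0 subr0.
Qed.

Lemma prim_cosZ c : prim (fun u : R => c * cos u) (pi / 2) = c.
Proof. by rewrite primZ ?prim_cos ?mulr1//; exact: continuous_cos. Qed.

Lemma pihalf_ge0 : 0 <= pi / 2 :> R.
Proof. by rewrite divr_ge0// pi_ge0. Qed.

Lemma cos_pihalf_ge0 u : 0 <= u <= pi / 2 -> 0 <= cos u.
Proof.
by move=> /andP[u0 u1]; apply: cos_ge0_pihalf; rewrite u1 andbT; have := pihalf_ge0; lra.
Qed.

Lemma cos2_itv u : 0 <= cos u ^+ 2 <= 1.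
Proof. by rewrite sqr_ge0/= -(cos2Dsin2 u) lerDl sqr_ge0. Qed.

Lemma asinhq0 : asinhq 0 = 1.
Proof.
rewrite -prim_cos /asinhq; congr (prim _ _); apply/funext => u.
by rewrite expr0n/= mul0r addr0 divr1.
Qed.

(** The integrand is the derivative in [u] of half the logarithm of
    [(kap y + y * sin u) / (kap y - y * sin u)]. *)
Lemma asinhqE y : y * kap y * asinhq y = ln (rho y).
Proof.
have k1 := kap_gt y; have k2 := kap_sqr y.
have pos u : 0 < kap y + y * sin u /\ 0 < kap y - y * sin u.
  have : `|y * sin u| < kap y.
    rewrite normrM; apply: le_lt_trans k1; rewrite ler_piMr// ler_norml.
    by rewrite sin_geN1 sin_le1.
  by rewrite ltr_norml; lra.
pose F (u : R) := 2^-1 * (ln (kap y + y * sin u) - ln (kap y - y * sin u)).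
have hF u : der F u (y * kap y * (cos u / (1 + y ^+ 2 * cos u ^+ 2))).
  have [p1 p2] := pos u.
  have dn : 1 + y ^+ 2 * cos u ^+ 2 = (kap y + y * sin u) * (kap y - y * sin u).
    have -> : (kap y + y * sin u) * (kap y - y * sin u) =
      kap y ^+ 2 - y ^+ 2 * sin u ^+ 2 by ring.
    by rewrite k2 [in RHS](_ : sin u ^+ 2 = 1 - cos u ^+ 2) ?sin2cos2//; ring.
  rewrite /F; apply: der_eq; first by der.
  by rewrite dn; field; rewrite !lt0r_neq0.
rewrite -primZ; last exact: ipn.
rewrite (primE (pi / 2) _ hF); last by apply: cts_mul; [cts|exact: ipn].
rewrite /F sin_pihalf sin0 !mulr0 !mulr1 subr0 addr0 subrr mulr0 subr0.
have -> : kap y - y = (rho y)^-1 by rewrite rhoV.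
by rewrite lnV ?posrE ?rho_gt0// /rho (addrC y); lra.
Qed.

Lemma tilt_diff s y : tilt s y * (s ^+ 2 - y ^+ 2) = y * kap y * (asinhq y - asinhq s).
Proof.
have c1 : continuous (fun u => y * kap y * (cos u / (1 + y ^+ 2 * cos u ^+ 2))).
  by apply: cts_mul; [cts|exact: ipn].
have c2 : continuous (fun u => - (y * kap y) * (cos u / (1 + s ^+ 2 * cos u ^+ 2))).
  by apply: cts_mul; [cts|exact: ipn].
rewrite /tilt /asinhq [LHS]mulrC [RHS]mulrBr -mulNr -!primZ// -primD//; congr (prim _ _).
apply/funext => u; rewrite /frac; field.
by rewrite !exprMn !den_neq0 ?sqr_ge0.
Qed.

Lemma tilt_incr s y z : y <= z -> tilt s y <= tilt s z.
Proof.
move=> yz; apply: prim_le_from0 => //; first exact: pihalf_ge0.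
move=> u /cos_pihalf_ge0 c0; apply: ler_wpM2l; last exact: frac_incr (cos2_itv u) yz.
by rewrite divr_ge0 ?exprn_ge0// ltW// frac_den// sqr_ge0.
Qed.

Lemma tilt0 s : tilt s 0 = 0.
Proof.
rewrite /tilt; under [X in prim X]eq_fun do rewrite /frac !mul0r mulr0.
by rewrite prim_cst mul0r.
Qed.

Lemma tilt_lip s y z : 0 <= y <= z -> tilt s z - tilt s y <= 2 * kap z ^+ 3 * (z - y).
Proof.
move=> yz; have k1 := kap_ge1 z.
rewrite lerBlDr addrC -[X in _ + X]prim_cosZ.
have cc : continuous (fun x : R => 2 * kap z ^+ 3 * (z - y) * cos x) by cts.
rewrite /tilt -primD//; apply: prim_le_from0 => //; first exact: cts_add.
  exact: pihalf_ge0.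
move=> u /cos_pihalf_ge0 c0; rewrite -lerBlDl -mulrBr.
have q01 := cos2_itv u.
have h := frac_lip q01 yz.
have h0 : 0 <= frac (cos u ^+ 2) z - frac (cos u ^+ 2) y.
  by rewrite subr_ge0 frac_incr//; case/andP: yz.
have d1 : 1 <= 1 + s ^+ 2 * cos u ^+ 2 by rewrite lerDl mulr_ge0// sqr_ge0.
have w0 : 0 <= cos u ^+ 3 / (1 + s ^+ 2 * cos u ^+ 2).
  by rewrite divr_ge0 ?exprn_ge0//; lra.
have w1 : cos u ^+ 3 / (1 + s ^+ 2 * cos u ^+ 2) <= cos u.
  rewrite ler_pdivrMr; last lra.
  rewrite exprS; apply: ler_wpM2l => //; case/andP: q01 => _; lra.
by rewrite [leRHS]mulrC; exact: ler_pM.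
Qed.

Lemma asinhq_le1 s : asinhq s <= 1.
Proof.
rewrite -prim_cos; apply: prim_le_from0 => //; [exact: continuous_cos|exact: pihalf_ge0|].
move=> u /cos_pihalf_ge0 c0; rewrite ler_pdivrMr ?frac_den ?sqr_ge0//.
by rewrite ler_peMr// lerDl mulr_ge0 ?sqr_ge0.
Qed.

Lemma asinhq_gt0 s : 0 < asinhq s.
Proof.
have : (1 + s ^+ 2)^-1 <= asinhq s; last first.
  by apply: lt_le_trans; rewrite invr_gt0 ltr_pwDl// sqr_ge0.
rewrite -[leLHS]prim_cosZ.
apply: prim_le_from0 => //; [by cts|exact: pihalf_ge0|].
move=> u /cos_pihalf_ge0 c0; rewrite mulrC ler_wpM2l// lef_pV2 ?posrE.
- by rewrite lerD2l ler_piMr ?sqr_ge0//; case/andP: (cos2_itv u).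
- by rewrite ltr_pwDl// sqr_ge0.
- by rewrite frac_den// sqr_ge0.
Qed.

(** For [s = sinh (h / 2)] the right-hand side is [(1 + h - h * coth h) / sinh h];
    pointwise, the bound comes from [s * kap s <= s^2 + 1 / 2]. *)
Lemma asinhq_tilt_gap s : (2 * (1 + s ^+ 2) ^+ 2)^-1 <= asinhq s - tilt s s.
Proof.
rewrite lerBrDr -[X in X + _]prim_cosZ.
have cc : continuous (fun x : R => (2 * (1 + s ^+ 2) ^+ 2)^-1 * cos x) by cts.
rewrite /tilt -primD//; apply: prim_le_from0 => //; first exact: cts_add.
  exact: pihalf_ge0.
move=> u /cos_pihalf_ge0 c0; set q := cos u ^+ 2.
have /andP[q0 q1] : 0 <= q <= 1 by exact: cos2_itv.
have dq : 0 < 1 + s ^+ 2 * q by rewrite frac_den.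
rewrite (_ : cos u ^+ 3 = cos u * q) ; last by rewrite exprS.
clearbody q.
have -> : cos u * q / (1 + s ^+ 2 * q) * frac q s =
   cos u * (q * (s * kap s) / (1 + s ^+ 2 * q) ^+ 2).
  by rewrite /frac; field; rewrite gt_eqF.
have -> : cos u / (1 + s ^+ 2 * q) = cos u * ((1 + s ^+ 2 * q) / (1 + s ^+ 2 * q) ^+ 2).
  by field; rewrite gt_eqF.
rewrite [X in X + _]mulrC -mulrDr; apply: ler_wpM2l => //.
rewrite -lerBrDr -mulrBl.
have s2 := sqr_ge0 s.
have sk : s * kap s <= s ^+ 2 + 2^-1.
  apply: le_trans (ler_norm _) _.
  rewrite -(ler_pXn2r (n := 2))// ?nnegrE//; last by lra.
  by rewrite real_normK ?num_real// exprMn kap_sqr; nra.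
have num : 2^-1 <= 1 + s ^+ 2 * q - q * (s * kap s) by nra.
apply: (@le_trans _ _ (2^-1 / (1 + s ^+ 2 * q) ^+ 2)); last first.
  by rewrite ler_wpM2r// invr_ge0 exprn_ge0// ltW.
rewrite invfM ler_wpM2l ?invr_ge0// lef_pV2 ?posrE ?exprn_gt0//; last by lra.
by rewrite ler_pXn2r ?nnegrE ?(ltW dq)//; [nra|lra].
Qed.

End Apsidal.

(** * The family of periodic orbits *)

Section OrbitFamily.
Variables (R : realType) (beta : R).
Hypothesis beta_gt0 : 0 < beta.
Implicit Types (p : R * R) (x : R).

(** The parameters of an orbit are its amplitude and the value of [gain] at its
    outer turning point. Taking the first as a square and the second as an
    exponential lets [p] range over the whole plane. *)
Definition amp p : R := p.1 ^+ 2.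
Definition eps p : R := expR p.2.
Definition ypos p x : R := amp p * cos x.
(** The distance to the origin is [r = sqrt c * rho y], with [- amp <= y <= amp],
    and conservation of energy reads [r'^2 = 2 * (amp^2 - y^2) * gain] (see
    [drad_sqr]). Writing [y = amp * cos x] removes the turning points. *)
Definition gain p x : R := eps p + beta * (tilt (amp p) (amp p) - tilt (amp p) (ypos p x)).
Definition glev p : R := eps p + beta * tilt (amp p) (amp p).
Definition del p : R := beta * asinhq (amp p).
(** With the length scale [c = 8 * pi^2 / period^2], these are [L^2 / c] and
    [alpha * c], for the angular momentum [L] and the coefficient [alpha] of the
    quadratic part of the potential. *)
Definition ell p : R := (glev p + del p) / 2.
Definition gam p : R := (glev p - del p) / 2.

(** Up to constant factors, the increments of time and of polar angle along the
    orbit, relative to that of [x]. *)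
Definition dtime p x : R := rho (ypos p x) / (kap (ypos p x) * Num.sqrt (gain p x)).
Definition dangle p x : R := (rho (ypos p x) * (kap (ypos p x) * Num.sqrt (gain p x)))^-1.
Definition period p : R := prim (dtime p) (2 * pi).
Definition apsis p : R := prim (dangle p) (2 * pi).

Definition clock p x : R := 2 * pi / period p * dtime p x.
Definition time p x : R := prim (clock p) x.
(** The inverse of [time]: [x] plays the role of Kepler's eccentric anomaly. *)
Definition anomaly p z : R := xget 0 [set x | time p x = z].

(** The mean angular speed, so that the orbit does not wind around the origin in
    the frame turning at this speed (see [angle_2pi]). *)
Definition larmor p : R := Num.sqrt (ell p / 2) * apsis p / (2 * pi).
Definition rad p x : R := 2 * pi * Num.sqrt 2 / period p * rho (ypos p x).
Definition drad p x : R := - (Num.sqrt 2 * amp p * sin x * Num.sqrt (gain p x)).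
Definition spin p x : R :=
  Num.sqrt (ell p / 2) * period p / (2 * pi * rho (ypos p x) ^+ 2) - larmor p.
Definition angle p x : R := prim (fun x => spin p x * clock p x) x.

(** This is [8 * pi^2 * (larmor^2 - alpha - beta)]. Every orbit of the family
    solves the equation of motion for its own [alpha]; the equation for waves
    demands [alpha = larmor^2 - beta]. *)
Definition mismatch p : R :=
  ell p * apsis p ^+ 2 - gam p * period p ^+ 2 - 8 * pi ^+ 2 * beta.

Lemma amp_ge0 p : 0 <= amp p. Proof. exact: sqr_ge0. Qed.

Lemma eps_gt0 p : 0 < eps p. Proof. exact: expR_gt0. Qed.

Lemma ypos_le p x : ypos p x <= amp p.
Proof. by rewrite /ypos ler_piMr ?amp_ge0// cos_le1. Qed.

Lemma gain_ge p x : eps p <= gain p x.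
Proof. by rewrite lerDl mulr_ge0 ?(ltW beta_gt0)// subr_ge0 tilt_incr// ypos_le. Qed.

Lemma gain_gt0 p x : 0 < gain p x.
Proof. exact: lt_le_trans (eps_gt0 p) (gain_ge p x). Qed.

Lemma sqrt_gain_gt0 p x : 0 < Num.sqrt (gain p x).
Proof. by rewrite sqrtr_gt0 gain_gt0. Qed.

Lemma del_gt0 p : 0 < del p.
Proof. by rewrite mulr_gt0// asinhq_gt0. Qed.

Lemma glev_gt0 p : 0 < glev p.
Proof.
rewrite ltr_pwDl ?eps_gt0// mulr_ge0 ?(ltW beta_gt0)// -(tilt0 (amp p)).
by rewrite tilt_incr// amp_ge0.
Qed.

Lemma ell_gt0 p : 0 < ell p.
Proof. by rewrite divr_gt0// addr_gt0 ?glev_gt0 ?del_gt0. Qed.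

Lemma dtime_gt0 p x : 0 < dtime p x.
Proof. by rewrite divr_gt0 ?rho_gt0// mulr_gt0 ?kap_gt0 ?sqrt_gain_gt0. Qed.

Lemma dangle_gt0 p x : 0 < dangle p x.
Proof. by rewrite invr_gt0 !mulr_gt0 ?rho_gt0 ?kap_gt0 ?sqrt_gain_gt0. Qed.

Section Continuity.
Variables (T : topologicalType) (f : T -> R * R) (h : T -> R).
Hypotheses (cf : continuous f) (ch : continuous h).

Lemma cts_amp : continuous (fun t => amp (f t)).
Proof. by rewrite /amp; cts. Qed.

Lemma cts_ypos : continuous (fun t => ypos (f t) (h t)).
Proof. by rewrite /ypos; apply: cts_mul; [exact: cts_amp|cts]. Qed.

Lemma cts_rho_ypos : continuous (fun t => rho (ypos (f t) (h t))).
Proof. by have c := cts_ypos; rewrite /rho; apply: cts_add => //; exact: cts_kap. Qed.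

Lemma cts_glev : continuous (fun t => glev (f t)).
Proof.
have c := cts_amp; rewrite /glev /eps; apply: cts_add; first by cts.
by apply: cts_mul; [cts|exact: cts_tilt].
Qed.

Lemma cts_del : continuous (fun t => del (f t)).
Proof. by apply: cts_mul; [cts|apply: cts_asinhq; exact: cts_amp]. Qed.

Lemma cts_ell : continuous (fun t => ell (f t)).
Proof. by have c1 := cts_glev; have c2 := cts_del; rewrite /ell; cts. Qed.

Lemma cts_gam : continuous (fun t => gam (f t)).
Proof. by have c1 := cts_glev; have c2 := cts_del; rewrite /gam; cts. Qed.

Lemma cts_gain : continuous (fun t => gain (f t) (h t)).
Proof.
have c := cts_amp; have c' := cts_ypos; rewrite /gain /eps; apply: cts_add; first by cts.
by apply: cts_mul; [cts|apply: cts_add; [|apply: cts_opp]; exact: cts_tilt].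
Qed.

Lemma cts_dtime : continuous (fun t => dtime (f t) (h t)).
Proof.
have c := cts_rho_ypos; apply: cts_mul => //; apply: cts_inv.
  by move=> t; rewrite mulf_neq0// gt_eqF// ?kap_gt0 ?sqrt_gain_gt0.
apply: cts_mul; first by apply: cts_kap; exact: cts_ypos.
by apply: cts_sqrt; exact: cts_gain.
Qed.

Lemma cts_dangle : continuous (fun t => dangle (f t) (h t)).
Proof.
apply: cts_inv.
  by move=> t; rewrite !mulf_neq0// gt_eqF// ?kap_gt0 ?rho_gt0 ?sqrt_gain_gt0.
apply: cts_mul; first exact: cts_rho_ypos.
apply: cts_mul; first by apply: cts_kap; exact: cts_ypos.
by apply: cts_sqrt; exact: cts_gain.
Qed.

End Continuity.

Lemma cts_period (T : topologicalType) (f : T -> R * R) : continuous f ->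
  continuous (fun t => period (f t)).
Proof.
move=> cf; apply: (@cts_comp _ _ _ (fun x : T * R => prim (dtime (f x.1)) x.2)
  (fun t => (t, 2 * pi))); last by cts.
apply: (@cts_prim R T (fun t => dtime (f t))).
by apply: cts_dtime; [apply: cts_comp => //; cts|cts].
Qed.

Lemma cts_apsis (T : topologicalType) (f : T -> R * R) : continuous f ->
  continuous (fun t => apsis (f t)).
Proof.
move=> cf; apply: (@cts_comp _ _ _ (fun x : T * R => prim (dangle (f x.1)) x.2)
  (fun t => (t, 2 * pi))); last by cts.
apply: (@cts_prim R T (fun t => dangle (f t))).
by apply: cts_dangle; [apply: cts_comp => //; cts|cts].
Qed.

Lemma twopi_gt0 : 0 < 2 * pi :> R.
Proof. by rewrite mulr_gt0// pi_gt0. Qed.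

Lemma dtime_cts p : continuous (dtime p).
Proof. by apply: (cts_dtime (f := fun _ => p) (h := id)); [exact: cts_cst|exact: cts_id]. Qed.

Lemma dangle_cts p : continuous (dangle p).
Proof. by apply: (cts_dangle (f := fun _ => p) (h := id)); [exact: cts_cst|exact: cts_id]. Qed.

Lemma period_gt0 p : 0 < period p.
Proof.
have := prim_lt (@dtime_cts p) (dtime_gt0 p) twopi_gt0.
by rewrite prim0//; exact: dtime_cts.
Qed.

Lemma apsis_gt0 p : 0 < apsis p.
Proof.
have := prim_lt (@dangle_cts p) (dangle_gt0 p) twopi_gt0.
by rewrite prim0//; exact: dangle_cts.
Qed.

Lemma clock_gt0 p x : 0 < clock p x.
Proof. by rewrite mulr_gt0 ?dtime_gt0// divr_gt0 ?twopi_gt0// period_gt0. Qed.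

Lemma rad_gt0 p x : 0 < rad p x.
Proof.
by rewrite mulr_gt0 ?rho_gt0// divr_gt0 ?period_gt0// mulr_gt0 ?twopi_gt0// sqrtr_gt0.
Qed.

Lemma larmor_gt0 p : 0 < larmor p.
Proof.
by rewrite divr_gt0 ?twopi_gt0// mulr_gt0 ?apsis_gt0// sqrtr_gt0 divr_gt0// ell_gt0.
Qed.

Section Continuity2.
Variables (T : topologicalType) (f : T -> R * R) (h : T -> R).
Hypotheses (cf : continuous f) (ch : continuous h).

Lemma cts_clock : continuous (fun t => clock (f t) (h t)).
Proof.
apply: cts_mul; last exact: cts_dtime.
apply: cts_mul; first by cts.
by apply: cts_inv; [move=> t; rewrite gt_eqF ?period_gt0|exact: cts_period].
Qed.

Lemma cts_larmor : continuous (fun t => larmor (f t)).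
Proof.
apply: cts_mul; last by cts.
apply: cts_mul; last exact: cts_apsis.
by apply: cts_sqrt; apply: cts_mul; [exact: cts_ell|cts].
Qed.

Lemma cts_rad : continuous (fun t => rad (f t) (h t)).
Proof.
apply: cts_mul; last exact: cts_rho_ypos.
apply: cts_mul; first by cts.
by apply: cts_inv; [move=> t; rewrite gt_eqF ?period_gt0|exact: cts_period].
Qed.

Lemma cts_drad : continuous (fun t => drad (f t) (h t)).
Proof.
apply: cts_opp; apply: cts_mul; last by apply: cts_sqrt; exact: cts_gain.
apply: cts_mul; last by cts.
by apply: cts_mul; [cts|exact: cts_amp].
Qed.

Lemma cts_spin : continuous (fun t => spin (f t) (h t)).
Proof.
apply: cts_add; last by apply: cts_opp; exact: cts_larmor.
apply: cts_mul.
  apply: cts_mul; last exact: cts_period.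
  by apply: cts_sqrt; apply: cts_mul; [exact: cts_ell|cts].
apply: cts_inv.
  by move=> t; rewrite !mulf_neq0// ?expf_neq0 ?gt_eqF ?rho_gt0 ?pi_gt0.
by apply: cts_mul; [cts|apply: cts_exp; exact: cts_rho_ypos].
Qed.

Lemma cts_mismatch : continuous (fun t => mismatch (f t)).
Proof.
have c1 := cts_ell cf; have c2 := cts_gam cf; have c3 := cts_period cf.
by have c4 := cts_apsis cf; rewrite /mismatch; cts.
Qed.

End Continuity2.

Lemma clock_cts p : continuous (clock p).
Proof. by apply: (cts_clock (f := fun _ => p) (h := id)); [exact: cts_cst|exact: cts_id]. Qed.

Lemma spin_cts p : continuous (spin p).
Proof. by apply: (cts_spin (f := fun _ => p) (h := id)); [exact: cts_cst|exact: cts_id]. Qed.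

Lemma cts_time (T : topologicalType) (f : T -> R * R) (h : T -> R) :
  continuous f -> continuous h -> continuous (fun t => time (f t) (h t)).
Proof.
move=> cf ch; apply: (@cts_comp _ _ _ (fun x : T * R => prim (clock (f x.1)) x.2)
  (fun t => (t, h t))); last by cts.
apply: (@cts_prim R T (fun t => clock (f t))).
by apply: cts_clock; [apply: cts_comp => //; cts|cts].
Qed.

Lemma cts_angle (T : topologicalType) (f : T -> R * R) (h : T -> R) :
  continuous f -> continuous h -> continuous (fun t => angle (f t) (h t)).
Proof.
move=> cf ch; apply: (@cts_comp _ _ _ (fun x : T * R =>
  prim (fun u => spin (f x.1) u * clock (f x.1) u) x.2)
  (fun t => (t, h t))); last by cts.
apply: (@cts_prim R T (fun t u => spin (f t) u * clock (f t) u)).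
have c : continuous (fun x : T * R => f x.1) by apply: cts_comp => //; cts.
by apply: cts_mul; [apply: cts_spin => //|apply: cts_clock => //]; cts.
Qed.

Lemma yposN p x : ypos p (- x) = ypos p x. Proof. by rewrite /ypos cosN. Qed.

Lemma ypos_periodic p x : ypos p (x + 2 * pi) = ypos p x.
Proof. by rewrite /ypos mulr_natl cosD2pi. Qed.

End OrbitFamily.

Section RadialMotion.
Variables (R : realType) (beta : R).
Hypothesis beta_gt0 : 0 < beta.
Implicit Types (p : R * R) (x y : R).

(** The second derivative of [rad] with respect to time. *)
Definition accel p x : R :=
  (- 2 * glev beta p * ypos p x * kap (ypos p x) - beta
   + del beta p * (1 + 2 * ypos p x ^+ 2)) / rad beta p x.

Definition energy p x : R :=
  2 * (glev beta p * (amp p ^+ 2 - ypos p x ^+ 2) - beta * ln (rho (ypos p x))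
       + del beta p * (ypos p x * kap (ypos p x))).

Lemma der_kap y : der kap y (y / kap y).
Proof.
have k0 : 0 < 1 + y ^+ 2 by rewrite ltr_pwDl// sqr_ge0.
rewrite /kap; apply: der_eq; first by der.
by rewrite -/(kap y) /= expr1; field; rewrite gt_eqF ?kap_gt0.
Qed.

Lemma der_rho y : der rho y (rho y / kap y).
Proof.
apply: der_eq; first by apply: der_add; [exact: der_id|exact: der_kap].
by rewrite /rho; field; rewrite gt_eqF ?kap_gt0.
Qed.

Lemma der_ypos p x : der (ypos p) x (- (amp p * sin x)).
Proof. by rewrite /ypos; apply: der_eq; [der|rewrite /=; ring]. Qed.

Lemma der_rad p x : der (rad beta p) x (drad beta p x * clock beta p x).
Proof.
apply: der_eq.
  apply: der_mul; first exact: der_cst.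
  by apply: der_comp; [exact: der_rho|exact: der_ypos].
rewrite /drad /clock /dtime; field.
by rewrite !gt_eqF ?kap_gt0 ?(sqrt_gain_gt0 beta_gt0) ?(period_gt0 beta_gt0).
Qed.

Lemma drad_sqr p x : drad beta p x ^+ 2 = energy p x.
Proof.
have gE : gain beta p x = glev beta p - beta * tilt (amp p) (ypos p x).
  by rewrite /gain /glev; ring.
have yE : ypos p x ^+ 2 = amp p ^+ 2 * cos x ^+ 2 by rewrite /ypos exprMn.
have -> : drad beta p x ^+ 2 = 2 * (amp p ^+ 2 * sin x ^+ 2) * gain beta p x.
  have g2 := sqr_sqrtr (ltW (gain_gt0 beta_gt0 p x)).
  have s2 : Num.sqrt (2 : R) ^+ 2 = 2 by rewrite sqr_sqrtr.
  by rewrite /drad sqrrN !exprMn g2 s2; ring.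
have -> : amp p ^+ 2 * sin x ^+ 2 = amp p ^+ 2 - ypos p x ^+ 2.
  by rewrite yE sin2cos2; ring.
have := tilt_diff (amp p) (ypos p x); have := asinhqE (ypos p x).
rewrite gE /energy /del => <- h.
set A := amp p ^+ 2 - _ in h *; set t := tilt _ _ in h *.
have -> : 2 * A * (glev beta p - beta * t) = 2 * glev beta p * A - 2 * beta * (t * A).
  by ring.
by rewrite h; ring.
Qed.

Lemma der_energy p x : der (energy p) x
  (- (2 * amp p * sin x) * (- 2 * glev beta p * ypos p x * kap (ypos p x) - beta
   + del beta p * (1 + 2 * ypos p x ^+ 2)) / kap (ypos p x)).
Proof.
have dy := der_ypos p x; set y := ypos p x in dy *.
have dk : der (fun x => kap (ypos p x)) x (y / kap y * - (amp p * sin x)).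
  by apply: der_comp dy; exact: der_kap.
have dr : der (fun x => rho (ypos p x)) x (rho y / kap y * - (amp p * sin x)).
  by apply: der_comp dy; exact: der_rho.
have r0 := rho_gt0 y.
rewrite /energy; apply: der_eq; first by der.
rewrite -/y /= ?expr1.
have -> : 1 + 2 * y ^+ 2 = kap y ^+ 2 + y ^+ 2 by rewrite kap_sqr; ring.
by field; rewrite !gt_eqF ?kap_gt0 ?rho_gt0.
Qed.

(** [accel * clock], a form in which the scale [period] cancels. *)
Definition ddrad p x : R :=
  (- 2 * glev beta p * ypos p x * kap (ypos p x) - beta
   + del beta p * (1 + 2 * ypos p x ^+ 2)) /
  (Num.sqrt 2 * kap (ypos p x) * Num.sqrt (gain beta p x)).

Lemma accel_clock p x : accel p x * clock beta p x = ddrad p x.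
Proof.
rewrite /accel /clock /rad /dtime /ddrad.
have pi0 : (pi : R) != 0 by rewrite gt_eqF ?pi_gt0.
move: (pi : R) pi0 => w w0; field.
by rewrite w0 !gt_eqF ?kap_gt0 ?rho_gt0 ?(sqrt_gain_gt0 beta_gt0)
  ?(period_gt0 beta_gt0) ?sqrtr_gt0.
Qed.

Lemma cts_ddrad p : continuous (ddrad p).
Proof.
have c0 : continuous (fun _ : R => p) by exact: cts_cst.
have c1 : continuous (fun x : R => x) by exact: cts_id.
have cy : continuous (fun x => ypos p x) := cts_ypos c0 c1.
have ck : continuous (fun x => kap (ypos p x)) := cts_kap cy.
have cg : continuous (fun x => gain beta p x) := cts_gain c0 c1.
apply: cts_mul; first by cts.
apply: cts_inv; last by cts.
move=> x; rewrite !mulf_neq0 ?gt_eqF ?kap_gt0 ?(sqrt_gain_gt0 beta_gt0) ?sqrtr_gt0//.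
Qed.

(** Away from the turning points [drad] is locally plus or minus the square root of
    [energy], so it may be differentiated without differentiating [gain]. *)
Lemma drad_der_regular p x : drad beta p x != 0 -> der (drad beta p) x (ddrad p x).
Proof.
set d0 := drad beta p x => d0_neq0.
have c0 : continuous (fun _ : R => p) by exact: cts_cst.
have cd : continuous (fun x => drad beta p x) := cts_drad c0 (@cts_id R).
have E0 : 0 < energy p x by rewrite -drad_sqr exprn_even_gt0.
have near_root : \forall y \near x, Num.sg d0 * Num.sqrt (energy p y) = drad beta p y.
  have [d0_gt0|d0_lt0|d00] := ltgtP d0 0; last by rewrite d00 eqxx in d0_neq0.
  - near=> y; rewrite ltr0_sg// -drad_sqr sqrtr_sqr ltr0_norm ?mulN1r ?opprK//.
    by near: y; apply: (cvgr_lt _ (cd x)).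
  - near=> y; rewrite gtr0_sg// -drad_sqr sqrtr_sqr gtr0_norm ?mul1r//.
    by near: y; apply: (cvgr_gt _ (cd x)).
apply: der_near near_root _.
have dE := der_energy p x.
apply: der_eq; first by der.
have -> : Num.sqrt (energy p x) = Num.sg d0 * d0.
  by rewrite -drad_sqr sqrtr_sqr -/d0 normrEsg.
have sg0 : Num.sg d0 != 0 by rewrite sgr_eq0.
rewrite mul0r add0r /ddrad.
move: d0_neq0 sg0; rewrite /d0 /drad => d0_neq0 sg0.
have s20 : Num.sqrt (2 : R) != 0 by rewrite gt_eqF// sqrtr_gt0.
move: d0_neq0; rewrite oppr_eq0 !mulf_eq0 !negb_or => /andP[/andP[/andP[_ a0] sx0] g0].
set w := Num.sg _ in sg0 *.
set X := (_ + del _ _ * _ : R).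
field.
have p1 : p.1 != 0 by case/andP: a0.
have A0 : 0 < amp p by rewrite exprn_even_gt0.
by rewrite ?p1 ?sx0 ?g0 ?s20 ?sg0 ?gt_eqF ?kap_gt0 ?A0.
Unshelve. all: by end_near. Qed.

(** At a turning point the formula for the second derivative follows from its
    validity nearby, both sides being continuous: the difference between
    [drad] and a primitive of [ddrad] is constant on each side. *)
Lemma der_drad_clock p x : der (drad beta p) x (ddrad p x).
Proof.
have [d0|] := eqVneq (drad beta p x) 0; last exact: drad_der_regular.
have c0 : continuous (fun _ : R => p) by exact: cts_cst.
have cd : continuous (fun x => drad beta p x) := cts_drad c0 (@cts_id R).
have [a0|a0] := eqVneq (amp p) 0.
  have -> : drad beta p = fun _ => 0.
    by apply/funext => y; rewrite /drad a0 mulr0 !mul0r oppr0.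
  apply: der_eq (der_cst _ _) _.
  by rewrite /ddrad /ypos /del a0 mul0r asinhq0 expr0n /=; ring.
have sx : sin x = 0.
  apply: contrapT => /eqP sx; move: d0 => /eqP; apply/negP.
  have g0 := sqrt_gain_gt0 beta_gt0 p x.
  have s20 : 0 < Num.sqrt (2 : R) by rewrite sqrtr_gt0.
  have s20' := negbT (gt_eqF s20); have g0' := negbT (gt_eqF g0).
  rewrite /drad oppr_eq0; exact: (mulf_neq0 (mulf_neq0 (mulf_neq0 s20' a0) sx) g0').
pose V y := drad beta p y - prim (ddrad p) y.
have cM : continuous (ddrad p) by exact: cts_ddrad.
have cV : continuous V.
  apply: cts_add => //; apply: cts_opp; apply: is_derive_cts => y; exact: prim_derive.
have dV y : 0 < `|y - x| < pi -> is_derive y 1 V 0.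
  move=> /andP[yx0 yxpi].
  have s0 : sin y != 0.
    have -> : sin y = cos x * sin (y - x).
      have c2 : cos x ^+ 2 = 1 by have := cos2Dsin2 x; rewrite sx; lra.
      rewrite sinB sx (_ : _ * _ = sin y * cos x ^+ 2); last by ring.
      by rewrite c2 mulr1.
    rewrite mulf_neq0//.
      by apply/eqP => cx; have := cos2Dsin2 x; rewrite sx cx; lra.
    have [h|h|h] := ltgtP (y - x) 0; last by rewrite h normr0 ltxx in yx0.
      rewrite -oppr_eq0 -sinN gt_eqF// sin_gt0_pi// oppr_gt0 h/=.
      by move: yxpi; rewrite ltr0_norm.
    by rewrite gt_eqF// sin_gt0_pi// h/=; move: yxpi; rewrite gtr0_norm.
  have h1 : der (drad beta p) y (ddrad p y).
    have g0' := negbT (gt_eqF (sqrt_gain_gt0 beta_gt0 p y)).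
    have s20 : 0 < Num.sqrt (2 : R) by rewrite sqrtr_gt0.
    apply: drad_der_regular; rewrite oppr_eq0.
    exact: (mulf_neq0 (mulf_neq0 (mulf_neq0 (negbT (gt_eqF s20)) a0) s0) g0').
  have h2 : der (prim (ddrad p)) y (ddrad p y) by exact: prim_derive.
  by apply: (der_eq (der_add h1 (der_opp h2))); rewrite subrr.
have Vx : \forall y \near x, V x = V y.
  have : \forall y \near x, `|y - x| < pi.
    have c : continuous (fun y => `|y - x|).
      by apply: cts_comp; [exact: norm_continuous|cts].
    by apply: (cvgr_lt _ (c x)); rewrite subrr normr0 pi_gt0.
  apply: filterS => y yx.
  have cW (u v : R) : {within `[u, v], continuous V} by exact: continuous_subspaceT.
  have [xy|yx'|->//] := ltgtP x y.
    have hz z : z \in `]x, y[ -> is_derive z 1 V 0.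
      rewrite in_itv/= => /andP[z1 z2]; apply: dV.
      rewrite gtr0_norm ?subr_gt0// z1/=.
      by move: yx; rewrite gtr0_norm ?subr_gt0//; lra.
    have [c _] := @MVT R V (fun _ => 0) x y xy hz (@cW x y).
    by rewrite mul0r => /eqP; rewrite subr_eq0 => /eqP.
  have hz z : z \in `]y, x[ -> is_derive z 1 V 0.
    rewrite in_itv/= => /andP[z1 z2]; apply: dV.
    rewrite ltr0_norm ?subr_lt0// opprB subr_gt0 z2/=.
    by move: yx; rewrite ltr0_norm ?subr_lt0//; lra.
  have [c _] := @MVT R V (fun _ => 0) y x yx' hz (@cW y x).
  by rewrite mul0r => /eqP; rewrite subr_eq0 => /eqP.
have h1 : der V x 0 by apply: (der_near Vx); exact: der_cst.
have h2 : der (prim (ddrad p)) x (ddrad p x) by exact: prim_derive.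
apply: der_near (der_eq (der_add h1 h2) (add0r _)).
by near=> y; rewrite /V subrK.
Unshelve. all: by end_near. Qed.

Lemma der_drad p x : der (drad beta p) x (accel p x * clock beta p x).
Proof. by rewrite accel_clock; exact: der_drad_clock. Qed.

End RadialMotion.

Section Anomaly.
Variables (R : realType) (beta : R).
Hypothesis beta_gt0 : 0 < beta.
Implicit Types (p : R * R) (x y z : R).

Lemma gainN p x : gain beta p (- x) = gain beta p x.
Proof. by rewrite /gain yposN. Qed.

Lemma gain_periodic p x : gain beta p (x + 2 * pi) = gain beta p x.
Proof. by rewrite /gain ypos_periodic. Qed.

Lemma clockN p x : clock beta p (- x) = clock beta p x.
Proof. by rewrite /clock /dtime yposN gainN. Qed.

Lemma clock_periodic p x : clock beta p (x + 2 * pi) = clock beta p x.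
Proof. by rewrite /clock /dtime ypos_periodic gain_periodic. Qed.

Lemma spinN p x : spin beta p (- x) = spin beta p x.
Proof. by rewrite /spin yposN. Qed.

Lemma spin_periodic p x : spin beta p (x + 2 * pi) = spin beta p x.
Proof. by rewrite /spin ypos_periodic. Qed.

Let ccl p : continuous (clock beta p) := @clock_cts R beta beta_gt0 p.

Let csc p : continuous (fun x => spin beta p x * clock beta p x).
Proof. by apply: cts_mul; [exact: spin_cts|exact: clock_cts]. Qed.

Lemma time_2pi p : time beta p (2 * pi) = 2 * pi.
Proof.
rewrite /time /clock primZ; last exact: dtime_cts.
by rewrite mulfVK// gt_eqF// period_gt0.
Qed.

Lemma time_periodic p x : time beta p (x + 2 * pi) = time beta p x + 2 * pi.
Proof. by rewrite -[in RHS](time_2pi p) /time prim_periodic// => y; exact: clock_periodic. Qed.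

Lemma timeN p x : time beta p (- x) = - time beta p x.
Proof. by rewrite /time prim_even// => y; exact: clockN. Qed.

Lemma time0 p : time beta p 0 = 0.
Proof. exact: prim0. Qed.

Lemma time_incr p x y : x < y -> time beta p x < time beta p y.
Proof. by apply: prim_lt => // z; exact: clock_gt0. Qed.

Lemma der_time p x : der (time beta p) x (clock beta p x).
Proof. exact: prim_derive. Qed.

(** Since [time] advances by [2 * pi] with [x], it takes every value. *)
Lemma time_anomaly p z : time beta p (anomaly beta p z) = z.
Proof.
rewrite /anomaly; case: xgetP => [x _ //|no].
pose n := (Num.truncn (`|z| / (2 * pi))).+1.
have zn : `|z| <= 2 * pi * n%:R.
  by rewrite mulrC -ler_pdivrMr ?twopi_gt0// ltW// truncnS_gt.
have tn m : time beta p (2 * pi * m%:R) = 2 * pi * m%:R.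
  elim: m => [|m IH]; first by rewrite mulr0 time0.
  by rewrite -[m.+1%:R]natr1 mulrDr mulr1 time_periodic IH.
have ct : continuous (time beta p) by apply: is_derive_cts => x; exact: der_time.
have n0 : - (2 * pi * n%:R) <= 2 * pi * n%:R :> R.
  by rewrite ge0_cp// mulr_ge0// ltW// twopi_gt0.
have [||c _ cz] := @IVT R (time beta p) _ _ z n0.
- exact: continuous_subspaceT.
- rewrite timeN tn; move: zn; rewrite ler_norml => /andP[z1 z2].
  by rewrite ge_min le_max z1 z2 orbT.
- by case: (no c cz).
Qed.

Lemma anomaly_time p x : anomaly beta p (time beta p x) = x.
Proof.
exact: (@gfK _ _ (time beta) (anomaly beta) time_incr time_anomaly).
Qed.

Lemma anomaly_periodic p z : anomaly beta p (z + 2 * pi) = anomaly beta p z + 2 * pi.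
Proof.
by rewrite -[in LHS](time_anomaly p z) -time_periodic anomaly_time.
Qed.

Lemma anomalyN p z : anomaly beta p (- z) = - anomaly beta p z.
Proof. by rewrite -[in LHS](time_anomaly p z) -timeN anomaly_time. Qed.

Lemma cts_anomaly (T : topologicalType) (f : T -> R * R) (h : T -> R) :
  continuous f -> continuous h -> continuous (fun t => anomaly beta (f t) (h t)).
Proof.
move=> cf ch; apply: (@cts_comp _ _ _ (fun x : (R * R) * R => anomaly beta x.1 x.2)
  (fun t => (f t, h t))); last by cts.
apply: (@cts_inverse R _ (time beta) (anomaly beta)).
- by apply: cts_time => //; cts.
- exact: time_incr.
- exact: time_anomaly.
Qed.

Lemma der_anomaly (F : R -> R) (dF : R -> R) p z :
  (forall x, der F x (dF x * clock beta p x)) ->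
  der (fun z => F (anomaly beta p z)) z (dF (anomaly beta p z)).
Proof.
move=> hF.
have da : der (anomaly beta p) z (clock beta p (anomaly beta p z))^-1.
  apply: (@der_inverse _ _ (time beta) (anomaly beta) time_incr time_anomaly).
    by move=> x; exact: der_time.
  by move=> x; rewrite gt_eqF// clock_gt0.
by apply: der_eq (der_comp (hF _) da) _; rewrite mulfK// gt_eqF// clock_gt0.
Qed.

Lemma der_angle p x : der (angle beta p) x (spin beta p x * clock beta p x).
Proof. exact: prim_derive. Qed.

(** Conservation of angular momentum: [spin + larmor] is proportional to
    [rad ^- 2]. *)
Lemma der_spin p x : der (spin beta p) x
  (- 2 * drad beta p x * (spin beta p x + larmor beta p) / rad beta p x * clock beta p x).
Proof.
have dr := der_rad beta_gt0 p x.
have c0 : 2 * pi * Num.sqrt 2 / period beta p != 0.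
  by rewrite gt_eqF// divr_gt0 ?period_gt0// mulr_gt0 ?twopi_gt0// sqrtr_gt0.
have r0 := rad_gt0 beta_gt0 p x.
have pi0 : 2 * (pi : R) != 0 by rewrite gt_eqF// twopi_gt0.
have spE : spin beta p = fun x => Num.sqrt (ell beta p / 2) * period beta p / (2 * pi)
    * (2 * pi * Num.sqrt 2 / period beta p) ^+ 2 * (rad beta p x ^+ 2)^-1 - larmor beta p.
  apply/funext => y; rewrite /spin /rad; congr (_ - _).
  have rh0 := rho_gt0 (ypos p y); move: c0 pi0.
  move: (2 * pi * Num.sqrt 2 / period beta p) => k k0.
  move: (2 * (pi : R)) => P P0; field.
  by rewrite k0 P0 gt_eqF.
rewrite spE; apply: der_eq.
  by der; rewrite expf_neq0// gt_eqF.
rewrite /= ?expr1.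
move: (Num.sqrt (ell beta p / 2) * _ / _ * _) => A.
by field; rewrite gt_eqF.
Qed.

Lemma angle_2pi p : angle beta p (2 * pi) = 0.
Proof.
have pi0 : (pi : R) != 0 by rewrite gt_eqF// pi_gt0.
have -> : angle beta p = prim (fun x =>
    Num.sqrt (ell beta p / 2) * dangle beta p x + - larmor beta p * clock beta p x).
  congr prim; apply/funext => x; rewrite /spin /clock /dtime /dangle mulrDl.
  congr (_ + _); move: (pi : R) pi0 => w w0; field.
  by rewrite w0 !gt_eqF ?rho_gt0 ?kap_gt0 ?sqrt_gain_gt0 ?period_gt0.
have cd : continuous (dangle beta p) by exact: dangle_cts.
transitivity (Num.sqrt (ell beta p / 2) * apsis beta p
  + - larmor beta p * time beta p (2 * pi)).
  have h1 : continuous (fun x => Num.sqrt (ell beta p / 2) * dangle beta p x).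
    by apply: cts_mul => //; exact: cts_cst.
  have h2 : continuous (fun x => - larmor beta p * clock beta p x).
    by apply: cts_mul; [exact: cts_cst|exact: ccl].
  have cl : continuous (clock beta p) by exact: ccl.
  by rewrite (primD _ h1 h2) (primZ _ _ cd) (primZ _ _ cl).
rewrite time_2pi /larmor.
by rewrite mulNr divfK ?subrr// mulf_neq0.
Qed.

Lemma angle_periodic p x : angle beta p (x + 2 * pi) = angle beta p x.
Proof.
rewrite /angle prim_periodic//; last by move=> y; rewrite spin_periodic clock_periodic.
by rewrite -/(angle beta p (2 * pi)) angle_2pi addr0.
Qed.

Lemma angleN p x : angle beta p (- x) = - angle beta p x.
Proof. by rewrite /angle prim_even// => y; rewrite spinN clockN. Qed.

Lemma radN p x : rad beta p (- x) = rad beta p x.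
Proof. by rewrite /rad yposN. Qed.

Lemma rad_periodic p x : rad beta p (x + 2 * pi) = rad beta p x.
Proof. by rewrite /rad ypos_periodic. Qed.

Lemma drad_periodic p x : drad beta p (x + 2 * pi) = drad beta p x.
Proof. by rewrite /drad gain_periodic mulr_natl sinD2pi. Qed.

Lemma accel_periodic p x : accel beta p (x + 2 * pi) = accel beta p x.
Proof. by rewrite /accel ypos_periodic rad_periodic. Qed.

(** The radial law [r'' = L^2 / r^3 - alpha * r - beta / r], with
    [L = r^2 * (spin + larmor)] and [alpha = gam * period^2 / (8 * pi^2)], in
    which the vanishing of [mismatch] replaces [alpha] by [larmor^2 - beta]. *)
Lemma accelE p x : mismatch beta p = 0 ->
  accel beta p x - rad beta p x * spin beta p x ^+ 2
    - 2 * larmor beta p * (rad beta p x * spin beta p x)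
  = beta * (1 - rad beta p x ^- 2) * rad beta p x.
Proof.
move=> m0.
have r0 := rad_gt0 beta_gt0 p x.
have J0 := period_gt0 beta_gt0 p.
have pi0 : 0 < (pi : R) by exact: pi_gt0.
have rh0 := rho_gt0 (ypos p x).
have l0 : 0 <= ell beta p / 2 by rewrite ltW// divr_gt0// ell_gt0.
have s2 : Num.sqrt (2 : R) ^+ 2 = 2 by rewrite sqr_sqrtr.
have rE : rad beta p x ^+ 2 = 8 * pi ^+ 2 / period beta p ^+ 2 * rho (ypos p x) ^+ 2.
  by rewrite /rad !exprMn s2 exprVn; ring.
have larmorE : larmor beta p ^+ 2 = ell beta p * apsis beta p ^+ 2 / (8 * pi ^+ 2).
  rewrite /larmor !exprMn sqr_sqrtr// exprVn.
  by move: (pi : R) pi0 => w w0; field; rewrite gt_eqF.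
have larmor2 : larmor beta p ^+ 2 = gam beta p * period beta p ^+ 2 / (8 * pi ^+ 2) + beta.
  have : ell beta p * apsis beta p ^+ 2 = gam beta p * period beta p ^+ 2 + 8 * pi ^+ 2 * beta.
    by move: m0; rewrite /mismatch; lra.
  by rewrite larmorE => ->; move: (pi : R) pi0 => w w0; field; rewrite gt_eqF.
have ws : (spin beta p x + larmor beta p) ^+ 2 =
    ell beta p * period beta p ^+ 2 / (8 * pi ^+ 2 * rho (ypos p x) ^+ 4).
  rewrite /spin subrK !exprMn sqr_sqrtr// exprVn.
  by move: (pi : R) pi0 => w w0; field; rewrite !gt_eqF.
have main : accel beta p x = rad beta p x * (spin beta p x + larmor beta p) ^+ 2
    - (larmor beta p ^+ 2 - beta) * rad beta p x - beta / rad beta p x.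
  apply: (mulIf (lt0r_neq0 r0)); rewrite divfK ?gt_eqF//.
  have -> : (rad beta p x * (spin beta p x + larmor beta p) ^+ 2
    - (larmor beta p ^+ 2 - beta) * rad beta p x - beta / rad beta p x) * rad beta p x
    = rad beta p x ^+ 2 * ((spin beta p x + larmor beta p) ^+ 2 - (larmor beta p ^+ 2 - beta)) - beta.
    by field; rewrite gt_eqF.
  rewrite ws larmor2 rE addrK.
  have -> : 8 * pi ^+ 2 / period beta p ^+ 2 * rho (ypos p x) ^+ 2 *
     (ell beta p * period beta p ^+ 2 / (8 * pi ^+ 2 * rho (ypos p x) ^+ 4) -
      gam beta p * period beta p ^+ 2 / (8 * pi ^+ 2)) =
     ell beta p * (rho (ypos p x))^-1 ^+ 2 - gam beta p * rho (ypos p x) ^+ 2.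
    by move: (pi : R) pi0 => w w0; field; rewrite !gt_eqF.
  rewrite rhoV /rho /ell /gam.
  have k2 := kap_sqr (ypos p x).
  have -> : (kap (ypos p x) - ypos p x) ^+ 2 =
     kap (ypos p x) ^+ 2 + ypos p x ^+ 2 - 2 * ypos p x * kap (ypos p x) by ring.
  have -> : (ypos p x + kap (ypos p x)) ^+ 2 =
     kap (ypos p x) ^+ 2 + ypos p x ^+ 2 + 2 * ypos p x * kap (ypos p x) by ring.
  by rewrite k2; field.
by rewrite main; field; rewrite gt_eqF.
Qed.

End Anomaly.

(** * The sign of the mismatch *)

Section SmallAngles.
Variable R : realType.
Implicit Types x : R.

Lemma sin_le x : 0 <= x -> sin x <= x.
Proof.
move=> x0.
have := @mvt_le R sin cos (fun y => y) (fun _ => 1) 0 x x0 (@is_derive_sin R)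
  (@der_id R) (fun y _ => cos_le1 y).
by rewrite sin0 !subr0.
Qed.

Lemma cos_ge x : 0 <= x -> 1 - x ^+ 2 / 2 <= cos x.
Proof.
move=> x0.
have h1 (y : R) : is_derive y 1 (fun y => - cos y) (sin y).
  by apply: (der_eq (a := - - sin y)); [der|rewrite opprK].
have h2 (y : R) : is_derive y 1 (fun y => y ^+ 2 / 2) y.
  by apply: der_eq; [der|rewrite /= expr1; field].
have := @mvt_le R _ _ _ _ 0 x x0 h1 h2 (fun y yx => sin_le (proj1 (andP yx))).
by rewrite cos0 expr0n /=; lra.
Qed.

End SmallAngles.

Section MismatchSign.
Variables (R : realType) (beta : R).
Hypothesis beta_gt0 : 0 < beta.
Implicit Types (p : R * R) (x : R).

(** [period] and [apsis] are the sum and the difference of [mean] and [skew]; the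
    skewness measures how much slower the motion is outside than inside. *)
Definition slow p x : R := (Num.sqrt (gain beta p x))^-1.
Definition mean p : R := prim (slow p) (2 * pi).
Definition skew p : R :=
  prim (fun x => ypos p x / kap (ypos p x) * slow p x) (2 * pi).

Let cg p : continuous (gain beta p).
Proof. by apply: (cts_gain (f := fun _ => p) (h := id)); [exact: cts_cst|exact: cts_id]. Qed.

Let cs p : continuous (slow p).
Proof.
apply: cts_inv; first by move=> x; rewrite gt_eqF// sqrt_gain_gt0.
by apply: cts_sqrt; exact: cg.
Qed.

Let ct p : continuous (fun x => ypos p x / kap (ypos p x)).
Proof.
have cy : continuous (fun x => ypos p x).
  by apply: (cts_ypos (f := fun _ => p) (h := id)); [exact: cts_cst|exact: cts_id].
apply: cts_mul => //; apply: cts_inv; first by move=> x; rewrite gt_eqF// kap_gt0.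
exact: cts_kap.
Qed.

Let cts p : continuous (fun x => ypos p x / kap (ypos p x) * slow p x).
Proof. by apply: cts_mul; [exact: ct|exact: cs]. Qed.

Lemma slow_gt0 p x : 0 < slow p x.
Proof. by rewrite invr_gt0 sqrt_gain_gt0. Qed.

Lemma periodE p : period beta p = mean p + skew p.
Proof.
rewrite /mean /skew -(primD _ (@cs p) (@cts p)) /period; congr (prim _ _).
apply/funext => x; rewrite /dtime /slow /rho.
by field; rewrite !gt_eqF ?kap_gt0 ?sqrt_gain_gt0.
Qed.

Lemma apsisE p : apsis beta p = mean p - skew p.
Proof.
have c : continuous (fun x => - 1 * (ypos p x / kap (ypos p x) * slow p x)).
  by apply: cts_mul; [exact: cts_cst|exact: cts].
rewrite -mulN1r /mean /skew -(primZ _ _ (@cts p)) -(primD _ (@cs p) c) /apsis.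
congr (prim _ _); apply/funext => x; rewrite /dangle /slow invfM rhoV.
by field; rewrite !gt_eqF ?kap_gt0 ?sqrt_gain_gt0.
Qed.

Lemma mismatchE p : mismatch beta p =
  - 2 * glev beta p * mean p * skew p + del beta p * (mean p ^+ 2 + skew p ^+ 2)
  - 8 * pi ^+ 2 * beta.
Proof. by rewrite /mismatch periodE apsisE /ell /gam; field. Qed.

Lemma prim_antiperiodic (f : R -> R) : continuous f ->
  (forall x, f (x + pi) = - f x) -> prim f (2 * pi) = 0.
Proof.
move=> cf fpi.
have h x : der (fun y => - prim f (y + pi)) x (f x).
  apply: der_eq.
    apply: der_opp; apply: der_comp; first exact: prim_derive.
    by apply: der_add; [exact: der_id|exact: der_cst].
  by rewrite fpi; ring.
have := primE pi cf h.
by rewrite add0r (_ : pi + pi = 2 * pi); [lra|ring].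
Qed.

(** Since [gain] decreases with [y], replacing it by its value at [y = 0] can only
    lower the integrand, and leaves an odd function of [cos x]. *)
Lemma skew_ge0 p : 0 <= skew p.
Proof.
pose G0 := eps p + beta * (tilt (amp p) (amp p) - tilt (amp p) 0).
have cc : continuous (fun x => (Num.sqrt G0)^-1 * (ypos p x / kap (ypos p x))).
  by apply: cts_mul; [exact: cts_cst|exact: ct].
have <- : prim (fun x => (Num.sqrt G0)^-1 * (ypos p x / kap (ypos p x))) (2 * pi) = 0.
  apply: prim_antiperiodic => // x.
  have -> : ypos p (x + pi) = - ypos p x by rewrite /ypos cosDpi mulrN.
  by rewrite kapN mulNr mulrN.
apply: (prim_le_from0 cc (@cts p) (ltW (twopi_gt0 R))).
move=> x _; rewrite mulrC.
have G00 : 0 < G0.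
  by rewrite ltr_pwDl ?eps_gt0// mulr_ge0 ?(ltW beta_gt0)// subr_ge0 tilt_incr ?amp_ge0.
have k0 := kap_gt0 (ypos p x); have g0 := gain_gt0 beta_gt0 p x.
have [y0|/ltW y0] := leP 0 (ypos p x).
  apply: ler_wpM2l; first by rewrite divr_ge0// ltW.
  rewrite lef_pV2 ?posrE ?sqrtr_gt0//; apply: ler_wsqrtr.
  by rewrite lerD2l ler_pM2l// lerD2l lerN2 tilt_incr.
apply: ler_wnM2l; first by rewrite mulr_le0_ge0// invr_ge0 ltW.
rewrite lef_pV2 ?posrE ?sqrtr_gt0//; apply: ler_wsqrtr.
by rewrite lerD2l ler_pM2l// lerD2l lerN2 tilt_incr.
Qed.

Lemma skew_le p : skew p <= mean p.
Proof.
apply: (prim_le_from0 (@cts p) (@cs p) (ltW (twopi_gt0 R))).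
move=> x _; rewrite ler_piMl ?(ltW (slow_gt0 p x))//.
have := kap_gt (ypos p x); rewrite ltr_norml => /andP[_ h].
by rewrite ler_pdivrMr ?kap_gt0// mul1r ltW.
Qed.

Lemma mean_gt0 p : 0 < mean p.
Proof.
have := prim_lt (@cs p) (slow_gt0 p) (twopi_gt0 R).
by rewrite prim0//; exact: cs.
Qed.

(** The two parts of [mismatch] that remain after dropping the nonpositive cross
    term are at most [2 * beta * mean^2], and [mean < 2 * pi] here. *)
Lemma mismatch_lt0 p : 1 < eps p -> mismatch beta p < 0.
Proof.
move=> e1; rewrite mismatchE.
have S0 := skew_ge0 p; have SC := skew_le p; have C0 := mean_gt0 p.
have d1 : del beta p <= beta by rewrite ler_piMr ?asinhq_le1// ltW.
have d0 := del_gt0 beta_gt0 p; have g0 := glev_gt0 beta_gt0 p.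
have pi0 := pi_gt0 R.
have C2 : mean p < 2 * pi.
  have q0 : 0 < Num.sqrt (eps p) by rewrite sqrtr_gt0 eps_gt0.
  have : mean p <= (Num.sqrt (eps p))^-1 * (2 * pi).
    have cc : continuous (fun _ : R => (Num.sqrt (eps p))^-1) by exact: cts_cst.
    rewrite -(prim_cst (Num.sqrt (eps p))^-1); apply: (prim_le_from0 (@cs p) cc (ltW (twopi_gt0 R))).
    move=> x _; rewrite lef_pV2 ?posrE ?sqrt_gain_gt0//.
    by apply: ler_wsqrtr; exact: gain_ge.
  move/le_lt_trans; apply; rewrite mulrC gtr_pMr ?twopi_gt0// invf_lt1//.
  by rewrite -[X in X < _]sqrtr1 ltr_sqrt ?eps_gt0.
have h1 : 0 <= 2 * glev beta p * mean p * skew p.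
  by rewrite !mulr_ge0// ltW.
have h2 : mean p ^+ 2 + skew p ^+ 2 < 8 * pi ^+ 2.
  have : skew p ^+ 2 <= mean p ^+ 2 by rewrite ler_pXn2r ?nnegrE// ltW.
  have : mean p ^+ 2 < (2 * pi) ^+ 2 by rewrite ltr_pXn2r ?nnegrE ?(ltW C0) ?(ltW (twopi_gt0 R)).
  by rewrite exprMn; lra.
have h3 : del beta p * (mean p ^+ 2 + skew p ^+ 2) < beta * (8 * pi ^+ 2).
  apply: (@le_lt_trans _ _ (beta * (mean p ^+ 2 + skew p ^+ 2))).
    by rewrite ler_wpM2r// addr_ge0// sqr_ge0.
  by rewrite ltr_pM2l.
lra.
Qed.

(** For small [eps] the orbit lingers at its outer turning point, which makes
    [mean] logarithmically large, while [del - glev] stays bounded below. Whatever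
    the value of [skew], [mismatch + 8 * pi^2 * beta] is at least
    [mean^2 * (del - glev)]. *)
Lemma mismatch_gt0 s1 : 0 < s1 -> exists2 e0, 0 < e0 < 1 &
  forall p, amp p <= s1 -> eps p = e0 -> 0 < mismatch beta p.
Proof.
move=> s10; pose K := 1 + s1 ^+ 2.
have K0 : 0 < K by rewrite ltr_pwDl// sqr_ge0.
pose B := beta * kap s1 ^+ 3 * s1.
have k0 : 0 < kap s1 by exact: kap_gt0.
have B0 : 0 < B by rewrite !mulr_gt0// exprn_gt0.
pose b := Num.sqrt B; have b0 : 0 < b by rewrite sqrtr_gt0.
have bB : b ^+ 2 = B by rewrite sqr_sqrtr// ltW.
have pi0 := pi_gt0 R.
(* [e <= e1] gives [6 * pi * K <= mean], and [e <= e2] keeps half of the gap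
   [beta / (2 * K^2)] between [del] and [glev]. *)
pose e1 := b * expR (- (6 * pi * K * b)).
pose e2 := Num.sqrt beta / (2 * K).
have e10 : 0 < e1 by rewrite mulr_gt0// expR_gt0.
have e20 : 0 < e2 by rewrite divr_gt0 ?sqrtr_gt0// mulr_gt0.
pose e := Num.min (Num.min e1 e2) 2^-1.
have e0 : 0 < e by rewrite !lt_min e10 e20 invr_gt0 ltr0n.
have [ee1 [ee2 ee3]] : e <= e1 /\ e <= e2 /\ e <= 2^-1.
  by rewrite !ge_min !lexx !orbT.
clearbody e b.
exists (e ^+ 2).
  rewrite exprn_gt0//= exprn_ilt1// ?ltW//; lra.
move=> p ps1 pe; rewrite mismatchE.
have s0 := amp_ge0 p; set s := amp p in ps1 s0 *.
have gap : beta / (4 * K ^+ 2) <= del beta p - glev beta p.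
  have h := asinhq_tilt_gap s.
  have h1 : (2 * K ^+ 2)^-1 <= (2 * (1 + s ^+ 2) ^+ 2)^-1.
    have P1 : 0 < 1 + s ^+ 2 by rewrite ltr_pwDl// sqr_ge0.
    rewrite lef_pV2 ?posrE ?mulr_gt0 ?exprn_gt0//.
    rewrite ler_pM2l// ler_pXn2r ?nnegrE ?(ltW P1) ?(ltW K0)//.
    by rewrite lerD2l ler_pXn2r ?nnegrE// ltW.
  have h2 : e ^+ 2 <= beta / (4 * K ^+ 2).
    have -> : beta / (4 * K ^+ 2) = e2 ^+ 2.
      rewrite /e2 exprMn sqr_sqrtr ?ltW// exprVn; congr (_ / _); ring.
    by rewrite ler_pXn2r ?nnegrE// ltW.
  rewrite /del /glev pe -/s.
  have -> : beta / (4 * K ^+ 2) = beta * (2 * K ^+ 2)^-1 - beta / (4 * K ^+ 2).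
    by field; rewrite gt_eqF.
  have : beta * (2 * K ^+ 2)^-1 <= beta * (asinhq s - tilt s s).
    by rewrite ler_pM2l//; lra.
  by rewrite mulrBr; lra.
have big : 6 * pi * K <= mean p.
  have m1 : prim (slow p) 1 <= mean p.
    have zc : continuous (fun _ : R => 0 : R) by exact: cts_cst.
    have p1 : 1 <= 2 * (pi : R) by have := pi_ge2 R; lra.
    have := prim_le zc (@cs p) p1 (fun x _ => ltW (slow_gt0 p x)).
    by rewrite !prim_cst /mean; lra.
  apply: le_trans m1.
  (* Near [x = 0], [gain <= e^2 + b^2 * x^2], and [F] is a primitive of the inverse
     square root of this bound. *)
  pose F x : R := b^-1 * ln (rho (b * x / e)).
  have hF x : der F x ((e * kap (b * x / e))^-1).
    have r0 := rho_gt0 (b * x / e).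
    have dr : der (fun x => rho (b * x / e)) x (rho (b * x / e) / kap (b * x / e) * (b / e)).
      apply: der_comp; first exact: der_rho.
      by apply: der_eq; [der|rewrite /=; ring].
    rewrite /F; apply: der_eq; first by der.
    move: (rho _) r0 => w w0; have := kap_gt0 (b * x / e).
    by move: (kap _) => k kk0; field; rewrite !gt_eqF.
  have cF : continuous (fun x => (e * kap (b * x / e))^-1).
    apply: cts_inv; first by move=> x; rewrite mulf_neq0// gt_eqF// kap_gt0.
    apply: cts_mul; first exact: cts_cst.
    apply: cts_kap; apply: cts_mul; last exact: cts_cst.
    by apply: cts_mul; [exact: cts_cst|exact: cts_id].
  have lower : prim (fun x => (e * kap (b * x / e))^-1) 1 <= prim (slow p) 1.
    apply: (prim_le_from0 cF (@cs p) ler01).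
    move=> x /andP[x0 x1].
    have kx : 0 < e * kap (b * x / e) by rewrite mulr_gt0// kap_gt0.
    rewrite lef_pV2 ?posrE ?sqrt_gain_gt0//.
    rewrite -[leRHS](ger0_norm (ltW kx)) -sqrtr_sqr; apply: ler_wsqrtr.
    rewrite exprMn kap_sqr.
    have -> : e ^+ 2 * (1 + (b * x / e) ^+ 2) = e ^+ 2 + B * x ^+ 2.
      by rewrite -bB; field; rewrite gt_eqF.
    rewrite /gain pe lerD2l /B -!mulrA ler_pM2l//.
    have c1 := cos_ge x0; have c2 := cos_le1 x.
    have y0 : 0 <= ypos p x by rewrite mulr_ge0//; nra.
    have ys := ypos_le p x.
    have h := @tilt_lip R s (ypos p x) s.
    apply: le_trans (h _) _; first by rewrite y0.
    have ks : kap s <= kap s1 by apply: le_kap; rewrite ger0_norm.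
    have k3 : kap s ^+ 3 <= kap s1 ^+ 3.
      by apply: lerXn2r; rewrite ?nnegrE ?(ltW (kap_gt0 _)).
    have sx : s - ypos p x <= s1 * (x ^+ 2 / 2).
      rewrite /ypos -/s -{1}[s]mulr1 -mulrBr ler_pM//; lra.
    have sy : 0 <= s - ypos p x by rewrite subr_ge0.
    have k30 : 0 <= kap s ^+ 3 by rewrite exprn_ge0// ltW// kap_gt0.
    rewrite -mulrA.
    have := ler_pM k30 sy k3 sx; lra.
  apply: le_trans lower; rewrite (primE 1 cF hF) /F mulr0 mul0r.
  have -> : rho (0 : R) = 1 by rewrite /rho /kap expr0n/= addr0 sqrtr1 add0r.
  rewrite ln1 mulr0 subr0 mulr1 [leRHS]mulrC ler_pdivlMr//.
  have be : 0 < b / e by rewrite divr_gt0.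
  have le1 : ln (b / e) <= ln (rho (b / e)).
    by rewrite ler_ln ?posrE ?rho_gt0// lerDl ltW// kap_gt0.
  apply: le_trans le1.
  rewrite -ler_expR lnK ?posrE// ler_pdivlMr//.
  have hb : b = expR (6 * pi * K * b) * e1.
    by rewrite /e1 mulrCA -expRD subrr expR0 mulr1.
  by rewrite [leRHS]hb ler_pM2l ?expR_gt0.
have d0 := del_gt0 beta_gt0 p; have g0 := glev_gt0 beta_gt0 p.
have gap0 : 0 < beta / (4 * K ^+ 2) by rewrite divr_gt0// mulr_gt0// exprn_gt0.
move: (mean p) (skew p) (del beta p) (glev beta p) big gap d0 g0 => C S d g big gap d0 g0.
(* Completing the square in [S]. *)
have low : C ^+ 2 * (d - g) <= - 2 * g * C * S + d * (C ^+ 2 + S ^+ 2).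
  rewrite -(ler_pM2l d0).
  have -> : d * (- 2 * g * C * S + d * (C ^+ 2 + S ^+ 2)) =
    (d * S - g * C) ^+ 2 + C ^+ 2 * ((d - g) * (d + g)) by ring.
  have h1 : 0 <= (d * S - g * C) ^+ 2 by exact: sqr_ge0.
  have h2 : 0 <= C ^+ 2 by exact: sqr_ge0.
  have h3 : 0 <= C ^+ 2 * ((d - g) * g).
    by rewrite mulr_ge0// mulr_ge0 ?ltW//; lra.
  nra.
have C2 : 36 * pi ^+ 2 * K ^+ 2 <= C ^+ 2.
  have -> : 36 * pi ^+ 2 * K ^+ 2 = (6 * pi * K) ^+ 2 by ring.
  by rewrite ler_pXn2r ?nnegrE//; [rewrite !mulr_ge0// ltW|apply: le_trans big; rewrite !mulr_ge0// ltW].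
have : 36 * pi ^+ 2 * K ^+ 2 * (beta / (4 * K ^+ 2)) <= C ^+ 2 * (d - g).
  apply: ler_pM => //; last exact: ltW.
  by apply: mulr_ge0; [apply: mulr_ge0; [exact: ler0n|]|]; exact: sqr_ge0.
have -> : 36 * pi ^+ 2 * K ^+ 2 * (beta / (4 * K ^+ 2)) = 9 * (pi ^+ 2 * beta).
  by move: (pi : R) => w; field; rewrite gt_eqF.
have : 0 < pi ^+ 2 * beta by rewrite mulr_gt0// exprn_gt0.
lra.
Qed.

End MismatchSign.

(** * Curves in the complex plane *)

Section ComplexCurves.
Variable R : realType.
Local Notation C := (Rcomplex R).

Definition mkC (a b : R) : C := (a +i* b)%C.

Lemma RcomplexE (z : C) : z = mkC (complex.Re z) (complex.Im z).
Proof. by case: z. Qed.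

Lemma norm_mkC (a b : R) : `|mkC a b| = Num.sqrt (a ^+ 2 + b ^+ 2).
Proof. by []. Qed.

Lemma norm_mkC_le (a b : R) : `|mkC a b| <= `|a| + `|b|.
Proof.
rewrite norm_mkC -[leRHS]ger0_norm ?addr_ge0// -sqrtr_sqr ler_wsqrtr//.
rewrite sqrrD !real_normK ?num_real//.
have : 0 <= `|a| * `|b| by exact: mulr_ge0.
by rewrite mulr2n; lra.
Qed.

Lemma Re_le (z : C) : `|complex.Re z| <= `|z|.
Proof.
by case: z => a b; rewrite norm_mkC -sqrtr_sqr ler_wsqrtr// lerDl sqr_ge0.
Qed.

Lemma Im_le (z : C) : `|complex.Im z| <= `|z|.
Proof.
by case: z => a b; rewrite norm_mkC -sqrtr_sqr ler_wsqrtr// lerDr sqr_ge0.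
Qed.

Lemma mkCB a b c d : mkC a b - mkC c d = mkC (a - c) (b - d).
Proof. by []. Qed.

Lemma mkCD a b c d : mkC a b + mkC c d = mkC (a + c) (b + d).
Proof. by []. Qed.

Lemma mkCZ (k : R) a b : k *: mkC a b = mkC (k * a) (k * b).
Proof. by []. Qed.

Lemma mkCM a b c d : mkC a b * mkC c d = mkC (a * c - b * d) (a * d + b * c).
Proof. by []. Qed.

Lemma cts_mkC (T : topologicalType) (f g : T -> R) : continuous f -> continuous g ->
  continuous (fun x => mkC (f x) (g x)).
Proof.
move=> cf cg x; apply/cvgrPdist_lt => e e0.
have e2 : 0 < e / 2 by apply: divr_gt0.
have := cf x; move/cvgrPdist_lt => /(_ _ e2) nf.
have := cg x; move/cvgrPdist_lt => /(_ _ e2) ng.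
near=> y; rewrite mkCB; apply: le_lt_trans (norm_mkC_le _ _) _.
rewrite [e]splitr; apply: ltrD; first by near: y.
by near: y.
Unshelve. all: by end_near. Qed.

Lemma cts_Re : continuous (@complex.Re R : C -> R).
Proof.
move=> x; apply/(@cvgrPdist_lt _ _ _ (nbhs (x : C)) (nbhs_filter (x : C))) => e e0.
have nb : nbhs x (ball x e) by exact: nbhsx_ballx.
apply: (@filterS _ (nbhs (x : C)) (nbhs_filter (x : C)) _ _ _ nb) => y; rewrite -ball_normE /= => xy.
have -> : complex.Re x - complex.Re y = complex.Re (x - y).
  by case: (x); case: (y).
exact: le_lt_trans (Re_le _) xy.
Qed.

Lemma cts_Im : continuous (@complex.Im R : C -> R).
Proof.
move=> x; apply/(@cvgrPdist_lt _ _ _ (nbhs (x : C)) (nbhs_filter (x : C))) => e e0.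
have nb : nbhs x (ball x e) by exact: nbhsx_ballx.
apply: (@filterS _ (nbhs (x : C)) (nbhs_filter (x : C)) _ _ _ nb) => y; rewrite -ball_normE /= => xy.
have -> : complex.Im x - complex.Im y = complex.Im (x - y).
  by case: (x); case: (y).
exact: le_lt_trans (Im_le _) xy.
Qed.

Definition derC (f : R -> C) (x : R) (d : C) : Prop := is_derive x 1 f d.

(** The difference quotient in direction [1], freed from the scaling [h *: 1]. *)
Lemma is_derive_cvg (V : normedModType R) (f : R -> V) (x : R) (d : V) :
  is_derive x 1 f d <-> h^-1 *: (f (h + x) - f x) @[h --> 0^'] --> d.
Proof.
split.
  move=> [df <-].
  have := df; rewrite /derivable => /cvg_ex[l hl].
  have E := cvg_lim (@norm_hausdorff _ V) hl.
  rewrite /derive; rewrite E.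
  move: hl; apply: cvg_trans; apply: near_eq_cvg; near=> h.
  by rewrite /= /GRing.scale /= mulr1.
move=> h.
have h' : (fun h : R => h^-1 *: (f (h *: (1 : R) + x) - f x)) @ 0^' --> d.
  move: h; apply: cvg_trans; apply: near_eq_cvg; near=> h.
  by rewrite /= /GRing.scale /= mulr1.
apply: DeriveDef; first by apply/cvg_ex; exists d.
exact: (cvg_lim (@norm_hausdorff _ V) h').
Unshelve. all: by end_near. Qed.

Lemma derC_mkC (f g : R -> R) (x a b : R) : der f x a -> der g x b ->
  derC (fun y => mkC (f y) (g y)) x (mkC a b).
Proof.
move=> /is_derive_cvg df /is_derive_cvg dg; apply/is_derive_cvg.
have cm : {for (a, b), continuous (fun q : R * R => mkC q.1 q.2)}.
  by apply: cts_mkC; cts.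
have := @cvg_comp _ _ _ (fun h => (h^-1 *: (f (h + x) - f x), h^-1 *: (g (h + x) - g x)))
  (fun q : R * R => mkC q.1 q.2) (0^') (nbhs (a, b)) _ (cvg_pair df dg) cm.
exact.
Qed.

Lemma derC_Re (f : R -> C) (x : R) d : derC f x d ->
  der (fun y => complex.Re (f y)) x (complex.Re d).
Proof.
move=> /is_derive_cvg df; apply/is_derive_cvg.
have := @cvg_comp _ _ _ (fun h => h^-1 *: (f (h + x) - f x)) (@complex.Re R : C -> R) (0^') _ _ df (@cts_Re d).
apply: cvg_trans; apply: near_eq_cvg; near=> h => /=.
by case: (f (h + x)) => ? ?; case: (f x).
Unshelve. all: by end_near. Qed.

Lemma derC_Im (f : R -> C) (x : R) d : derC f x d ->
  der (fun y => complex.Im (f y)) x (complex.Im d).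
Proof.
move=> /is_derive_cvg df; apply/is_derive_cvg.
have := @cvg_comp _ _ _ (fun h => h^-1 *: (f (h + x) - f x)) (@complex.Im R : C -> R) (0^') _ _ df (@cts_Im d).
apply: cvg_trans; apply: near_eq_cvg; near=> h => /=.
by case: (f (h + x)) => ? ?; case: (f x).
Unshelve. all: by end_near. Qed.

Lemma derC_eq (f : R -> C) x a b : derC f x a -> a = b -> derC f x b.
Proof. by move=> h <-. Qed.

Lemma derC_mul (f g : R -> C) (x : R) a b : derC f x a -> derC g x b ->
  derC (fun y => f y * g y) x (a * g x + f x * b).
Proof.
move=> df dg.
have f1 := derC_Re df; have f2 := derC_Im df.
have g1 := derC_Re dg; have g2 := derC_Im dg.
have -> : (fun y => f y * g y) = (fun y => mkC
   (complex.Re (f y) * complex.Re (g y) - complex.Im (f y) * complex.Im (g y))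
   (complex.Re (f y) * complex.Im (g y) + complex.Im (f y) * complex.Re (g y))).
  by apply/funext => y; case: (f y) => ? ?; case: (g y).
apply: derC_eq; first by apply: derC_mkC; der.
case: (f x) (g x) a b {df dg f1 f2 g1 g2} => [? ?] [? ?] [? ?] [? ?] /=.
by rewrite -!/(mkC _ _) !mkCM mkCD; congr mkC; ring.
Qed.

Lemma derC_comp (f : R -> C) (h : R -> R) (x b : R) a : derC f (h x) a -> der h x b ->
  derC (fun y => f (h y)) x (b *: a).
Proof.
move=> df dh; have f1 := derC_Re df; have f2 := derC_Im df.
have -> : (fun y => f (h y)) =
    (fun y => mkC (complex.Re (f (h y))) (complex.Im (f (h y)))).
  by apply/funext => y; rewrite -RcomplexE.
apply: derC_eq.
  apply: derC_mkC.
    by apply: (@der_comp _ (fun y => complex.Re (f y)) h); eassumption.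
  by apply: (@der_comp _ (fun y => complex.Im (f y)) h); eassumption.
by rewrite [in RHS](RcomplexE a) mkCZ !(mulrC b).
Qed.

Lemma derC_cst (c : C) x : derC (fun _ => c) x 0.
Proof. exact: is_derive_cst. Qed.

Lemma derC_derive1 (f : R -> C) (df : R -> C) : (forall x, derC f x (df x)) ->
  f^`()%classic = df.
Proof. by move=> h; apply/funext => x; rewrite derive1E; case: (h x). Qed.

Lemma derC_derivable (f : R -> C) x d : derC f x d -> derivable f x 1.
Proof. by case. Qed.

Lemma derivable_derC (f : R -> C) x : derivable f x 1 -> derC f x (f^`()%classic x).
Proof. by move=> df; apply: DeriveDef => //; rewrite derive1E. Qed.

End ComplexCurves.

(** * The waves of the family *)

Section Waves.
Variables (R : realType) (beta : R).
Hypothesis beta_gt0 : 0 < beta.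
Implicit Types (p : R * R) (x y z : R).
Local Notation C := (Rcomplex R).

(** Real and imaginary parts of the wave [rad * exp (i * angle)] and of its first two
    derivatives in time, as functions of the anomaly. The conservation of angular
    momentum turns the angular component of the acceleration into
    [- 2 * larmor * drad]. *)
Definition wre p x : R := rad beta p x * cos (angle beta p x).
Definition wim p x : R := rad beta p x * sin (angle beta p x).
Definition wre1 p x : R := drad beta p x * cos (angle beta p x)
  - rad beta p x * spin beta p x * sin (angle beta p x).
Definition wim1 p x : R := drad beta p x * sin (angle beta p x)
  + rad beta p x * spin beta p x * cos (angle beta p x).
Definition wre2 p x : R :=
  (accel beta p x - rad beta p x * spin beta p x ^+ 2) * cos (angle beta p x)
  + 2 * larmor beta p * drad beta p x * sin (angle beta p x).
Definition wim2 p x : R :=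
  (accel beta p x - rad beta p x * spin beta p x ^+ 2) * sin (angle beta p x)
  - 2 * larmor beta p * drad beta p x * cos (angle beta p x).

Definition wave p z : C := mkC (wre p (anomaly beta p z)) (wim p (anomaly beta p z)).
Definition wave1 p z : C := mkC (wre1 p (anomaly beta p z)) (wim1 p (anomaly beta p z)).
Definition wave2 p z : C := mkC (wre2 p (anomaly beta p z)) (wim2 p (anomaly beta p z)).

Lemma derC_wave p z : derC (wave p) z (wave1 p z).
Proof.
apply: derC_mkC; apply: (der_anomaly beta_gt0) => x.
  have dr := der_rad beta_gt0 p x; have da := der_angle beta_gt0 p x.
  by rewrite /wre; apply: der_eq; [der|rewrite /wre1 /=; ring].
have dr := der_rad beta_gt0 p x; have da := der_angle beta_gt0 p x.
by rewrite /wim; apply: der_eq; [der|rewrite /wim1 /=; ring].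
Qed.

Lemma derC_wave1 p z : derC (wave1 p) z (wave2 p z).
Proof.
apply: derC_mkC; apply: (der_anomaly beta_gt0) => x;
  have dr := der_rad beta_gt0 p x; have da := der_angle beta_gt0 p x;
  have du := der_drad beta_gt0 p x; have dw := der_spin beta_gt0 p x;
  have r0 := rad_gt0 beta_gt0 p x.
  rewrite /wre1; apply: der_eq; first by der.
  by rewrite /wre2 /=; field; rewrite gt_eqF.
rewrite /wim1; apply: der_eq; first by der.
by rewrite /wim2 /=; field; rewrite gt_eqF.
Qed.

Section Continuity.
Variables (T : topologicalType) (f : T -> R * R) (h : T -> R).
Hypotheses (cf : continuous f) (ch : continuous h).

Lemma cts_accel : continuous (fun t => accel beta (f t) (h t)).
Proof.
have cy := cts_ypos cf ch; have ck := cts_kap cy.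
have c1 := @cts_glev R beta T f cf; have c2 := @cts_del R beta T f cf.
apply: cts_mul; last first.
  apply: cts_inv; first by move=> t; rewrite gt_eqF// rad_gt0.
  exact: cts_rad.
by cts.
Qed.

Let cr := cts_rad beta_gt0 cf ch.
Let cu := @cts_drad R beta T f h cf ch.
Let cw := cts_spin beta_gt0 cf ch.
Let ca := cts_angle beta_gt0 cf ch.
Let cacc := cts_accel.
Let csg := cts_larmor beta_gt0 cf.

Lemma cts_wre : continuous (fun t => wre (f t) (h t)).
Proof. by rewrite /wre; cts. Qed.

Lemma cts_wim : continuous (fun t => wim (f t) (h t)).
Proof. by rewrite /wim; cts. Qed.

Lemma cts_wre1 : continuous (fun t => wre1 (f t) (h t)).
Proof. by rewrite /wre1; cts. Qed.

Lemma cts_wim1 : continuous (fun t => wim1 (f t) (h t)).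
Proof. by rewrite /wim1; cts. Qed.

Lemma cts_wre2 : continuous (fun t => wre2 (f t) (h t)).
Proof. by rewrite /wre2; cts. Qed.

Lemma cts_wim2 : continuous (fun t => wim2 (f t) (h t)).
Proof. by rewrite /wim2; cts. Qed.

End Continuity.

Lemma cts_wave (T : topologicalType) (f : T -> R * R) (h : T -> R) :
  continuous f -> continuous h -> continuous (fun t => wave (f t) (h t)).
Proof.
move=> cf ch; have ca := cts_anomaly beta_gt0 cf ch.
by apply: cts_mkC; [exact: cts_wre|exact: cts_wim].
Qed.

Lemma cts_wave1 (T : topologicalType) (f : T -> R * R) (h : T -> R) :
  continuous f -> continuous h -> continuous (fun t => wave1 (f t) (h t)).
Proof.
move=> cf ch; have ca := cts_anomaly beta_gt0 cf ch.
by apply: cts_mkC; [exact: cts_wre1|exact: cts_wim1].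
Qed.

Lemma cts_wave2 (T : topologicalType) (f : T -> R * R) (h : T -> R) :
  continuous f -> continuous h -> continuous (fun t => wave2 (f t) (h t)).
Proof.
move=> cf ch; have ca := cts_anomaly beta_gt0 cf ch.
by apply: cts_mkC; [exact: cts_wre2|exact: cts_wim2].
Qed.

Lemma wave_periodic p z : wave p (z + 2 * pi) = wave p z.
Proof.
by rewrite /wave anomaly_periodic// /wre /wim rad_periodic angle_periodic.
Qed.

Lemma wave1_periodic p z : wave1 p (z + 2 * pi) = wave1 p z.
Proof.
by rewrite /wave1 anomaly_periodic// /wre1 /wim1 rad_periodic drad_periodic spin_periodic angle_periodic.
Qed.

Lemma wave2_periodic p z : wave2 p (z + 2 * pi) = wave2 p z.
Proof.
rewrite /wave2 anomaly_periodic// /wre2 /wim2 rad_periodic drad_periodic.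
by rewrite spin_periodic angle_periodic// accel_periodic.
Qed.

Lemma waveN p z : wave p (- z) = cconj (wave p z).
Proof.
rewrite /wave anomalyN// /wre /wim radN angleN// cosN sinN mulrN.
by [].
Qed.

Lemma wave_derive1 p : (wave p)^`()%classic = wave1 p.
Proof. by apply: derC_derive1 => z; exact: derC_wave. Qed.

Lemma wave_derive2 p : (wave p)^`(2)%classic = wave2 p.
Proof.
by rewrite derive1nS derive1n1 wave_derive1; apply: derC_derive1 => z; exact: derC_wave1.
Qed.

Lemma norm_wave p z : `|wave p z| = rad beta p (anomaly beta p z).
Proof.
rewrite norm_mkC /wre /wim; set x := anomaly _ _ _.
have -> : (rad beta p x * cos (angle beta p x)) ^+ 2 +
    (rad beta p x * sin (angle beta p x)) ^+ 2 =
    rad beta p x ^+ 2 * (cos (angle beta p x) ^+ 2 + sin (angle beta p x) ^+ 2) by ring.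
by rewrite cos2Dsin2 mulr1 sqrtr_sqr gtr0_norm// rad_gt0.
Qed.

Lemma wave_neq0 p z : wave p z != 0.
Proof. by rewrite -normr_eq0 norm_wave gt_eqF// rad_gt0. Qed.

Lemma wave_profile p : profile (wave p).
Proof.
split.
- by move=> z; exact: derC_derivable (derC_wave p z).
- by move=> z; rewrite wave_derive1; exact: derC_derivable (derC_wave1 p z).
- rewrite wave_derive2; apply: (cts_wave2 (f := fun _ => p) (h := id)).
    exact: cts_cst.
  exact: cts_id.
- exact: wave_periodic.
- exact: waveN.
Qed.

End Waves.

Section TravelingWaves.
Variable R : realType.
Local Notation C := (Rcomplex R).
Variables (omega : R) (k : int) (v v1 v2 : R -> C).
Hypothesis dv : forall z, derC v z (v1 z).
Hypothesis dv1 : forall z, derC v1 z (v2 z).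

Lemma twave_dt t s : d_t (twave k v) t s = v1 (t + k%:~R * s).
Proof.
rewrite /d_t; have h x : derC ((twave k v)^~ s) x (v1 (x + k%:~R * s)).
  apply: derC_eq.
    by apply: (@derC_comp _ v); [exact: dv|der].
  by rewrite addr0 scale1r.
by rewrite (derC_derive1 h).
Qed.

Lemma twave_dss t s : d_ss (twave k v) t s = k%:~R ^+ 2 *: v2 (t + k%:~R * s).
Proof.
have dk x : der (fun s => t + k%:~R * s) x (k%:~R).
  by apply: der_eq; [der|rewrite /=; ring].
rewrite /d_ss derive1nS derive1n1.
have h x : derC (twave k v t) x (k%:~R *: v1 (t + k%:~R * x)).
  by apply: (@derC_comp _ v); [exact: dv|exact: dk].
rewrite (derC_derive1 h).
have h2 x : derC (fun x => k%:~R *: v1 (t + k%:~R * x)) x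
    (k%:~R ^+ 2 *: v2 (t + k%:~R * x)).
  rewrite expr2 -scalerA; apply: is_deriveZ.
  by apply: (@derC_comp _ v1); [exact: dv1|exact: dk].
by rewrite (derC_derive1 h2).
Qed.

Lemma trav_mapE Omega t s : trav_map omega (twave k v) Omega t s =
  - (@cI R * (Omega *: v1 (t + k%:~R * s))) - k%:~R ^+ 2 *: v2 (t + k%:~R * s)
  + (omega * (1 - `|v (t + k%:~R * s)| ^- 2)) *: v (t + k%:~R * s).
Proof. by rewrite /trav_map twave_dt twave_dss. Qed.

End TravelingWaves.

Section BranchPoints.
Variables (R : realType) (beta : R).
Hypothesis beta_gt0 : 0 < beta.
Implicit Types (p : R * R) (x y z : R).
Local Notation C := (Rcomplex R).

(** The [Omega] for which [larmor] is the Larmor speed of the equation. *)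
Definition freq (k : int) p : R := 2 * k%:~R ^+ 2 * larmor beta p.

Lemma wave_trav (k : int) p t s : mismatch beta p = 0 ->
  trav_map (k%:~R ^+ 2 * beta) (twave k (wave beta p)) (freq k p) t s = 0.
Proof.
move=> m0.
rewrite (trav_mapE _ _ (derC_wave beta_gt0 p) (derC_wave1 beta_gt0 p)).
rewrite norm_wave//; set z := t + _; set x := anomaly beta p z.
have r0 := rad_gt0 beta_gt0 p x.
rewrite /wave /wave1 /wave2 -/x /cI -[(0 +i* 1)%C]/(mkC 0 1).
rewrite !mkCZ mkCM; set K : R := k%:~R.
have aE := accelE beta_gt0 x m0.
have {aE} : accel beta p x = rad beta p x * spin beta p x ^+ 2
    + 2 * larmor beta p * (rad beta p x * spin beta p x)
    + beta * (1 - rad beta p x ^- 2) * rad beta p x by rewrite -aE; ring.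
rewrite /wre /wim /wre1 /wim1 /wre2 /wim2 /freq -/K => ->.
move: (rad beta p x ^- 2) => ri; move: (rad beta p x) {r0} => r.
move: (cos _) (sin _) (spin _ _ _) (drad _ _ _) (larmor _ _) => c s' w u sg.
rewrite -[0 in RHS]/(mkC 0 0).
transitivity (mkC
  (- (0 * (2 * K ^+ 2 * sg * (u * c - r * w * s')) - 1 * (2 * K ^+ 2 * sg * (u * s' + r * w * c)))
   - K ^+ 2 * ((r * w ^+ 2 + 2 * sg * (r * w) + beta * (1 - ri) * r - r * w ^+ 2) * c + 2 * sg * u * s')
   + K ^+ 2 * beta * (1 - ri) * (r * c))
  (- (0 * (2 * K ^+ 2 * sg * (u * s' + r * w * c)) + 1 * (2 * K ^+ 2 * sg * (u * c - r * w * s')))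
   - K ^+ 2 * ((r * w ^+ 2 + 2 * sg * (r * w) + beta * (1 - ri) * r - r * w ^+ 2) * s' - 2 * sg * u * c)
   + K ^+ 2 * beta * (1 - ri) * (r * s'))); first by [].
by congr mkC; ring.
Qed.

Lemma wave_zeros (k : int) p : k != 0 -> mismatch beta p = 0 ->
  zeros (k%:~R ^+ 2 * beta) k (wave beta p, freq k p).
Proof.
move=> k0 m0; split; last by move=> t s; exact: wave_trav.
split=> /=; [exact: wave_profile|by move=> z; exact: wave_neq0|].
by rewrite mulr_gt0 ?larmor_gt0// mulr_gt0// exprn_even_gt0//= intr_eq0.
Qed.

(** The two points are the turning points [x = 0] and [x = pi]. *)
Lemma modulus_ratio p : exists z0 z1, `|wave beta p z0| = rho (amp p) ^+ 2 * `|wave beta p z1|.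
Proof.
exists (time beta p 0), (time beta p pi); rewrite !norm_wave// !anomaly_time//.
have r0 := rho_gt0 (amp p).
rewrite /rad /ypos cos0 cospi mulr1 mulrN1.
have -> : rho (- amp p) = (rho (amp p))^-1 by rewrite rhoV /rho kapN addrC.
by field; rewrite !gt_eqF ?period_gt0.
Qed.

Lemma rho_ge1 y : 0 <= y -> 1 + y <= rho y.
Proof. by move=> y0; have := kap_ge1 y; rewrite /rho; lra. Qed.

Lemma wave_nontrivial p : p.1 != 0 -> wave beta p <> cst 1.
Proof.
move=> p0 w1; have [z0 [z1]] := modulus_ratio p.
have n1 z : `|wave beta p z| = 1.
  rewrite w1 -[cst 1 z]/(mkC 1 0) norm_mkC expr1n expr0n/= addr0 sqrtr1//.
rewrite !n1 mulr1 => /eqP; apply/negP; rewrite lt_eqF//.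
have a0 : 0 < amp p by rewrite exprn_even_gt0.
have := rho_ge1 (ltW a0); set r := rho _; move=> h; nra.
Qed.

(** At amplitude zero the orbit is a circle run at constant speed. *)
Section Center.
Variable p : R * R.
Hypothesis p1 : p.1 = 0.

Let a0 : amp p = 0. Proof. by rewrite /amp p1 expr0n. Qed.
Let y0 x : ypos p x = 0. Proof. by rewrite /ypos a0 mul0r. Qed.
Let k0 : kap (0 : R) = 1. Proof. by rewrite /kap expr0n /= addr0 sqrtr1. Qed.
Let r0 : rho (0 : R) = 1. Proof. by rewrite /rho k0 add0r. Qed.
Let g0 x : gain beta p x = eps p.
Proof. by rewrite /gain y0 a0 subrr mulr0 addr0. Qed.
Let e0 : 0 < Num.sqrt (eps p). Proof. by rewrite sqrtr_gt0 eps_gt0. Qed.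
Let per : period beta p = 2 * pi / Num.sqrt (eps p).
Proof.
have -> : period beta p = prim (fun _ => (Num.sqrt (eps p))^-1) (2 * pi).
  by rewrite /period; congr prim; apply/funext => x; rewrite /dtime y0 k0 r0 g0 !mul1r.
by rewrite prim_cst mulrC.
Qed.
Let aps : apsis beta p = period beta p.
Proof.
by rewrite /apsis /period; congr prim; apply/funext => x;
  rewrite /dtime /dangle y0 k0 r0 !mul1r.
Qed.
Let gl : glev beta p = eps p. Proof. by rewrite /glev a0 tilt0 mulr0 addr0. Qed.
Let de : del beta p = beta. Proof. by rewrite /del a0 asinhq0 mulr1. Qed.

Lemma mismatch_center : mismatch beta p = 4 * pi ^+ 2 * beta * ((eps p)^-1 - 2).
Proof.
rewrite /mismatch aps per /ell /gam gl de exprMn exprVn sqr_sqrtr ?ltW ?eps_gt0//.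
by field; rewrite gt_eqF// eps_gt0.
Qed.

Lemma wave_center : eps p = 2^-1 -> wave beta p = cst 1.
Proof.
move=> e2; have pi0 : (pi : R) != 0 by rewrite gt_eqF ?pi_gt0.
have radE x : rad beta p x = 1.
  have s2 : Num.sqrt (2 : R) * Num.sqrt 2^-1 = 1.
    by rewrite -sqrtrM// mulfV// sqrtr1.
  rewrite /rad y0 r0 mulr1 per invf_div e2.
  have -> : 2 * pi * Num.sqrt 2 * (Num.sqrt 2^-1 / (2 * pi)) =
      (Num.sqrt 2 * Num.sqrt 2^-1) * ((2 * pi) / (2 * pi)) :> R by ring.
  by rewrite s2 mul1r divff// mulf_neq0.
have spinE x : spin beta p x = 0.
  by rewrite /spin /larmor y0 r0 expr1n mulr1 aps subrr.
have angleE x : angle beta p x = 0.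
  rewrite /angle; have -> : (fun x => spin beta p x * clock beta p x) = fun _ => 0.
    by apply/funext => y; rewrite spinE mul0r.
  by rewrite prim_cst mul0r.
apply/funext => z; rewrite /wave /wre /wim radE angleE cos0 sin0 mulr1 mulr0.
by [].
Qed.

Lemma freq_center (k : int) : eps p = 2^-1 ->
  freq k p = `|k%:~R| * Num.sqrt (k%:~R ^+ 2 + 2 * (k%:~R ^+ 2 * beta)).
Proof.
move=> e2; have pi0 : 0 < (pi : R) by exact: pi_gt0.
have sE : larmor beta p = Num.sqrt (ell beta p / 2) * Num.sqrt 2.
  rewrite /larmor aps per e2 sqrtrV// invrK.
  by move: (pi : R) pi0 => w w0; field; rewrite gt_eqF.
rewrite /freq sE -sqrtrM; last by rewrite divr_ge0// ltW// ell_gt0.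
rewrite divfK// /ell gl de e2.
have -> : k%:~R ^+ 2 + 2 * (k%:~R ^+ 2 * beta) =
   k%:~R ^+ 2 * (2 ^+ 2 * ((2^-1 + beta) / 2)) :> R by field.
move: ((_ + _) / _) => X.
have sq (u w : R) : Num.sqrt (u ^+ 2 * w) = `|u| * Num.sqrt w.
  by rewrite sqrtrM ?sqr_ge0// sqrtr_sqr.
have n2 : `|2 : R| = 2 by rewrite ger0_norm.
rewrite !sq n2.
have kk : `|k%:~R : R| * `|k%:~R| = k%:~R ^+ 2.
  by rewrite -normrM -expr2 ger0_norm// sqr_ge0.
by rewrite -kk; ring.
Qed.

End Center.

End BranchPoints.

(** * The bifurcating branch *)

Section UniformContinuity.
Variable R : realType.
Local Notation C := (Rcomplex R).

Lemma periodic_int (X : Type) (h : R -> X) (P : R) : (forall u, h (u + P) = h u) ->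
  forall (n : int) u, h (u + P * n%:~R) = h u.
Proof.
move=> hP.
have hn (m : nat) u : h (u + P * m%:R) = h u.
  elim: m u => [|m IH] u; first by rewrite mulr0 addr0.
  by rewrite -[m.+1%:R]natr1 mulrDr mulr1 addrA hP IH.
case=> m u; first exact: hn.
by rewrite NegzE mulrNz mulrN -[LHS](hn m.+1) subrK.
Qed.

Lemma periodic_representative (P y : R) : 0 < P ->
  exists (n : int) u, `|u| <= P /\ y = u + P * n%:~R.
Proof.
move=> P0; exists (Num.floor (y / P)), (y - P * (Num.floor (y / P))%:~R).
split; last by rewrite subrK.
have /andP[] := floor_itv (y / P); rewrite intrD.
set w := y / P; set n := (Num.floor w)%:~R => h1 h2.
have -> : y = P * w by rewrite /w mulrC divfK// gt_eqF.
rewrite -mulrBr normrM (gtr0_norm P0) ler_piMr ?(ltW P0)// ger0_norm; lra.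
Qed.

Lemma cts_uniform (T : topologicalType) (f : T -> R -> C) :
  continuous (fun x : T * R => f x.1 x.2) -> (forall p u, f p (u + 2 * pi) = f p u) ->
  continuous (fun p => f p : {uniform R -> C}).
Proof.
move=> cf fper p W /uniform_nbhs[E [entE sub]].
move: entE; rewrite -entourage_ballE => -[e /= e0 eE].
have := near_uniform p (2 * pi) cf e0.
apply: filterS => q h; apply: sub => y _.
have [n [u [uP ->]]] := periodic_representative y (twopi_gt0 R).
by rewrite !periodic_int//; apply: eE; exact: h.
Qed.

End UniformContinuity.

Section Branch.
Variables (R : realType) (beta : R) (k : int).
Hypothesis beta_gt0 : 0 < beta.
Local Notation C := (Rcomplex R).

Definition branch (p : R * R) : ambient R := (wave beta p : R -> C, freq beta k p).

(** The jets are jointly continuous in the parameter and in [z], and periodic in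
    [z], hence continuous in the parameter uniformly in [z]. *)
Lemma cts_branch : continuous branch.
Proof.
have c1 : continuous (fun x : (R * R) * R => x.1) by cts.
have c2 : continuous (fun x : (R * R) * R => x.2) by cts.
have cw : continuous (fun p => wave beta p : C2top R).
  apply: continuous_comp_initial.
  have -> : @jet2 R \o wave beta = (fun p => (wave beta p : {uniform R -> C},
      wave1 beta p : {uniform R -> C}, wave2 beta p : {uniform R -> C})).
    by apply/funext => p; rewrite -[LHS]/(jet2 (wave beta p)) /jet2 wave_derive2// wave_derive1.
  apply: cts_pair; first apply: cts_pair.
  - by apply: cts_uniform; [exact: cts_wave|exact: wave_periodic].
  - by apply: cts_uniform; [exact: cts_wave1|exact: wave1_periodic].
  - by apply: cts_uniform; [exact: cts_wave2|exact: wave2_periodic].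
apply: cts_pair => //.
have cid : continuous (fun p : R * R => p) by exact: cts_id.
by rewrite /freq; apply: cts_mul; [exact: cts_cst|exact: cts_larmor].
Qed.

End Branch.

Section Bifurcation.
Variables (R : realType) (beta : R) (k : int).
Hypothesis beta_gt0 : 0 < beta.
Hypothesis k_neq0 : k != 0.
Local Notation C := (Rcomplex R).
Local Notation omega := (k%:~R ^+ 2 * beta).
Local Notation Omega0 := (`|k%:~R| * Num.sqrt (k%:~R ^+ 2 + 2 * omega)).

Definition center : R * R := (0, ln 2^-1).

Lemma eps_center : eps center = 2^-1.
Proof. by rewrite /eps lnK// posrE invr_gt0. Qed.

Lemma branch_center : branch beta k center = triv Omega0.
Proof. by rewrite /branch /triv wave_center ?eps_center// (freq_center _ _ _ eps_center). Qed.

Lemma center_mismatch : mismatch beta center = 0.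
Proof. by rewrite mismatch_center// eps_center invrK subrr mulr0. Qed.

Lemma center_unique p : p.1 = 0 -> mismatch beta p = 0 -> p = center.
Proof.
move=> p1; rewrite mismatch_center// => /eqP; rewrite mulf_eq0 gt_eqF/=; last first.
  by rewrite mulr_gt0// mulr_gt0// exprn_gt0// pi_gt0.
rewrite subr_eq0 => /eqP e2; case: p p1 e2 => p1 p2 /= -> e2.
congr pair; apply: expR_inj; rewrite -[LHS]/(eps (0, p2)) -[LHS]invrK e2.
by rewrite lnK// posrE invr_gt0.
Qed.

(** Otherwise the center would be isolated in [K]. *)
Lemma center_limit (K : set (R * R)) (q : R * R) U : connected K -> K center -> K q ->
  q.1 != 0 -> (forall p, K p -> p.1 = 0 -> p = center) -> nbhs center U ->
  exists p, [/\ K p, p.1 != 0 & U p].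
Proof.
move=> cK Kc Kq q1 uniq_c Uc; apply: contrapT => no.
have h p : K p -> U p -> p = center.
  move=> Kp Up; apply: uniq_c => //; apply/eqP; apply: contrapT => /negP p1.
  by apply: no; exists p.
have E : [set center] = K.
  apply: cK; first by exists center.
  - exists (interior U); first exact: open_interior.
    apply/seteqP; split=> [p ->|p [Kp Up]]; first by split.
    by apply: h => //; exact: interior_subset.
  - exists ((fun p : R * R => p.1) @^-1` [set 0]).
      apply: closed_comp; last exact: closed_eq.
      by move=> x _; exact: cvg_fst.
    by apply/seteqP; split=> [p ->|p [Kp p1]]; [split|exact: uniq_c].
by move: Kq q1; rewrite -E => -> /=; rewrite eqxx.
Qed.

(** The zero set of [mismatch] crosses the rectangle of the parameters whose
    amplitude is at most [s1], and the component of the center is carried by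
    [branch] into the component of the bifurcation point. *)
Lemma branch_reaches s1 : 0 < s1 -> exists2 q, amp q = s1 &
  connected_component (bif_set omega k) (triv Omega0) (branch beta k q).
Proof.
move=> s10; have [e0 /andP[e00 e01] He] := mismatch_gt0 beta_gt0 s10.
pose a1 := Num.sqrt s1; have a10 : 0 < a1 by rewrite sqrtr_gt0.
have a12 : a1 ^+ 2 = s1 by rewrite sqr_sqrtr// ltW.
have bot x : 0 <= x <= a1 -> 0 < mismatch beta (x, ln e0).
  move=> /andP[x0 x1]; apply: He; last by rewrite /eps lnK.
  by rewrite /amp -a12 ler_pXn2r ?nnegrE// ltW.
have top x : 0 <= x <= a1 -> mismatch beta (x, 1) < 0.
  by move=> _; apply: mismatch_lt0 => //; rewrite /eps expR_gt1.
have e02 : e0 < 2^-1.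
  have := bot 0; rewrite lexx ltW//= => /(_ isT).
  rewrite mismatch_center// pmulr_rgt0; last first.
    by rewrite mulr_gt0// mulr_gt0// exprn_gt0// pi_gt0.
  rewrite /eps lnK// subr_gt0 => h.
  by rewrite -[e0]invrK ltf_pV2 ?posrE ?invr_gt0.
have lne : ln e0 < ln 2^-1 by rewrite ltr_ln ?posrE ?invr_gt0.
have ln2 : ln (2^-1 : R) < 0.
  by rewrite ln_lt0// invr_gt0 ltr0n/= invf_lt1// ltr1n.
have cm : continuous (mismatch beta).
  by apply: (cts_mismatch beta_gt0 (f := fun p => p)); exact: cts_id.
pose Z := [set p : R * R | [/\ mismatch beta p = 0, 0 <= p.1 <= a1 & ln e0 <= p.2 <= 1]].
have Zc : Z center.
  by split; [exact: center_mismatch|rewrite /= lexx ltW|rewrite /= !ltW//; lra].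
have le1 : ln e0 < 1 by lra.
have Zu p : Z p -> p.1 = 0 -> p = center by move=> [m0 _ _] p1; exact: center_unique.
have [q q1 Kq] := zero_continuum cm a10 le1 bot top Zc Zu erefl.
exists q; first by rewrite /amp q1.
set K := connected_component _ _ in Kq.
have cK : connected K by exact: component_connected.
have KZ : K `<=` Z by exact: connected_component_sub.
have Kc : K center by exact: connected_component_refl.
have cb : continuous (branch beta k) by exact: cts_branch.
have Nz p : Z p -> p.1 != 0 -> nontrivial_zeros omega k (branch beta k p).
  by move=> [m0 _ _] p1; split; [exact: wave_zeros|exact: wave_nontrivial].
have sub : branch beta k @` K `<=` bif_set omega k.
  move=> _ [p Kp <-]; have Zp := KZ _ Kp; split.
    by case: Zp => m0 _ _; case: (wave_zeros beta_gt0 k_neq0 m0).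
  have [p1|p1] := eqVneq p.1 0; last exact: subset_closure (Nz p Zp p1).
  rewrite (Zu p Zp p1) => W /cb Wc.
  have q10 : q.1 != 0 by rewrite q1 gt_eqF.
  have Ku r : K r -> r.1 = 0 -> r = center by move=> /KZ; exact: Zu.
  have [p' [Kp' p'1 Wp']] := center_limit cK Kc Kq q10 Ku Wc.
  by exists (branch beta k p'); split => //; apply: Nz => //; exact: KZ.
have cBK : connected (branch beta k @` K).
  by apply: connected_continuous_connected => //; exact: continuous_subspaceT.
rewrite -branch_center; apply: (connected_component_max _ sub cBK); last by exists q.
by exists center.
Qed.

(** A bounded component with moduli bounded away from [0] would bound the ratio of
    the extreme moduli of its waves, that is, the amplitudes. *)
Lemma global_bifurcation_branch : global_bifurcation omega k Omega0.
Proof.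
split.
  apply: contrapT => h; have [q _] := branch_reaches ltr01.
  by rewrite connected_component_out.
left; set B := connected_component _ _.
have [[M hM]|h] := pselect (C2_bounded B); last by apply: Or31.
have [[d d0 hd]|h] := pselect (modulus_away_from_0 B); last by apply: Or32.
exfalso; pose s1 := `|M| / d + 1.
have s10 : 0 < s1 by rewrite ltr_wpDl// divr_ge0// ltW.
have [q qs Bq] := branch_reaches s10.
have [z0 [z1 E]] := modulus_ratio beta_gt0 q.
have [_ /(_ z0)[b0 _ _]] := hM _ Bq.
have b1 := hd _ Bq z1.
move: b0 b1; rewrite /= E qs => b0 b1.
have r1 : 1 + s1 <= rho s1 by apply: rho_ge1; exact: ltW.
have : s1 * d <= rho s1 ^+ 2 * `|wave beta q z1|.
  by apply: ler_pM => //; rewrite ?ltW//; nra.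
rewrite /s1 mulrDl divfK ?gt_eqF// mul1r; have := ler_norm M; lra.
Qed.

End Bifurcation.

(** * From waves to filaments *)

Section Filament.
Variable R : realType.
Local Notation C := (Rcomplex R).

Lemma scaleC (r : R) (z : C) : r *: z = mkC r 0 * z.
Proof. by case: z => a b; rewrite mkCM !mul0r subr0 addr0. Qed.

Lemma normCM (x y : C) : `|(x * y : C)| = `|x| * `|y| :> R.
Proof. exact: ComplexField.Normc.normcM. Qed.

Lemma cI2 : @cI R * cI R = -1.
Proof. by rewrite /cI -[(0 +i* 1)%C]/(mkC 0 1) mkCM; congr mkC; ring. Qed.

Lemma norm_cexp (u : R) : `|cexp u| = 1.
Proof. by rewrite norm_mkC cos2Dsin2 sqrtr1. Qed.

Lemma derC_cexp (w t : R) : derC (fun t => cexp (w * t)) t (w *: (@cI R * cexp (w * t))).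
Proof.
apply: derC_eq; first by apply: derC_mkC; der.
rewrite /cI -[(0 +i* 1)%C]/(mkC 0 1) -[cexp _]/(mkC _ _) mkCM mkCZ.
by congr mkC; rewrite /=; ring.
Qed.

(** All differences [u_j - u_i] are [a_j - a_i] times the same nonzero factor, so the
    interaction term of the filaments reduces, by the equation for [a], to the
    nonlinearity of the equation for [v]. *)
Lemma wave_filament (omega : R) (k : int) (v : R -> C) (Omega : R) (n : nat) (a : 'I_n -> C) :
  zeros omega k (v, Omega) -> central_configuration omega a ->
  filament_solution (filament_wave omega k a v Omega).
Proof.
move=> [[/= [dv dv1 _ _ _] v0 _] eqn] [ainj acc].
have hv (z : R) : derC v z (v^`()%classic z) by exact: derivable_derC.
have hv1 (z : R) : derC v^`()%classic z (v^`(2)%classic z).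
  by rewrite derive1nS derive1n1; exact: derivable_derC.
pose v1 := v^`()%classic; pose v2 := v^`(2)%classic.
pose e t := cexp (omega * t).
have ht j t s : derC ((filament_wave omega k a v Omega j)^~ s) t
    (a j * (omega *: (@cI R * e t)) * v (Omega * t + k%:~R * s)
     + a j * e t * (Omega *: v1 (Omega * t + k%:~R * s))).
  have da : derC (fun t => a j * e t) t (a j * (omega *: (@cI R * e t))).
    by apply: derC_eq (derC_mul (derC_cst _ _) (derC_cexp _ _)) _; rewrite mul0r add0r.
  apply: (derC_mul da).
  apply: (@derC_comp _ v (fun t => Omega * t + k%:~R * s)); first exact: hv.
  by apply: der_eq; [der|rewrite /=; ring].
have dk (t : R) x : der (fun s => Omega * t + k%:~R * s) x (k%:~R).
  by apply: der_eq; [der|rewrite /=; ring].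
have hs j t s : derC (filament_wave omega k a v Omega j t) s
    (a j * e t * (k%:~R *: v1 (Omega * t + k%:~R * s))).
  apply: derC_eq; first apply: (derC_mul (derC_cst (a j * e t) _)).
    by apply: (@derC_comp _ v); [exact: hv|exact: dk].
  by rewrite mul0r add0r.
have hs1 j t : (filament_wave omega k a v Omega j t)^`()%classic =
    fun s => a j * e t * (k%:~R *: v1 (Omega * t + k%:~R * s)).
  by apply: derC_derive1 => s; exact: hs.
have hss j t s : derC (filament_wave omega k a v Omega j t)^`()%classic s
    (a j * e t * (k%:~R ^+ 2 *: v2 (Omega * t + k%:~R * s))).
  rewrite hs1; apply: derC_eq; first apply: (derC_mul (derC_cst (a j * e t) _)).
    apply: is_deriveZ; apply: (@derC_comp _ v1); [exact: hv1|exact: dk].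
  by rewrite mul0r add0r scalerA -expr2.
have e1 t : e t != 0 by rewrite -normr_eq0 norm_cexp oner_neq0.
split; first by move=> j t s; exact: derC_derivable (ht j t s).
split; first by move=> j t s; exact: derC_derivable (hs j t s).
split; first by move=> j t s; exact: derC_derivable (hss j t s).
split.
  move=> i j t s ij; rewrite /filament_wave; apply: contra_neq ij => h.
  by apply: ainj; apply: (mulIf (e1 t)); apply: (mulIf (v0 (Omega * t + k%:~R * s))).
move=> j t s.
have -> : d_t (filament_wave omega k a v Omega j) t s =
    a j * (omega *: (@cI R * e t)) * v (Omega * t + k%:~R * s)
     + a j * e t * (Omega *: v1 (Omega * t + k%:~R * s)).
  by rewrite /d_t derive1E; case: (ht j t s).
have -> : d_ss (filament_wave omega k a v Omega j) t s =
    a j * e t * (k%:~R ^+ 2 *: v2 (Omega * t + k%:~R * s)).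
  by rewrite /d_ss derive1nS derive1n1 derive1E; case: (hss j t s).
set z := Omega * t + k%:~R * s.
have -> : \sum_(i < n | i != j)
    `|filament_wave omega k a v Omega j t s - filament_wave omega k a v Omega i t s| ^- 2 *:
     (filament_wave omega k a v Omega j t s - filament_wave omega k a v Omega i t s)
   = `|v z| ^- 2 *: ((omega *: a j) * (e t * v z)).
  rewrite acc mulr_suml scaler_sumr; apply: eq_bigr => i _.
  have -> : filament_wave omega k a v Omega j t s - filament_wave omega k a v Omega i t s
      = (a j - a i) * (e t * v z) by rewrite /filament_wave -!mulrA -mulrBl.
  rewrite !normCM norm_cexp mul1r exprMn invfM.
  by rewrite [in RHS](scaleC (`|a j - a i| ^- 2)) -mulrA -scaleC scalerA mulrC.
have := eqn z 0; rewrite (trav_mapE _ _ hv hv1) mulr0 addr0 -/v1 -/v2.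
move: (a j) (e t) (v z) (v1 z) (v2 z) (`|v z| ^- 2) => A E V V1 V2 N.
have sM (r r' : R) : mkC (r * r') 0 = mkC r 0 * mkC r' 0.
  by rewrite mkCM; congr mkC; ring.
have sB (r : R) : mkC (1 - r) 0 = 1 - mkC r 0.
  have -> : (1 : C) = mkC 1 0 by [].
  by rewrite mkCB; congr mkC; ring.
rewrite !scaleC sM sB => T0.
apply/eqP; rewrite -subr_eq0; apply/eqP.
(* Multiplied by [i * a_j * exp (i * omega * t)], the equation for [v] is the one to be
   proved. *)
rewrite -[RHS](mulr0 (@cI R * A * E)) -T0.
apply/eqP; rewrite -subr_eq0; apply/eqP.
transitivity ((@cI R * @cI R + 1) * (A * E * (mkC Omega 0 * V1))); first by ring.
by rewrite cI2 addNr mul0r.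
Qed.

End Filament.

Theorem theorem22 (R : realType) (omega : R) (k : int) :
  0 < omega -> irrational omega -> 1 <= k ->
  global_bifurcation omega k
    (`|k%:~R| * Num.sqrt (k%:~R ^+ 2 + 2 * omega)) /\
  forall (v : R -> Rcomplex R) (Omega : R), zeros omega k (v, Omega) ->
    forall (n : nat) (a : 'I_n -> Rcomplex R),
      central_configuration omega a ->
      filament_solution (filament_wave omega k a v Omega).
Proof.
move=> omega_gt0 _ k_ge1; split; last first.
  by move=> v Omega vz n a; exact: wave_filament.
have k_neq0 : k != 0 by rewrite gt_eqF//; exact: lt_le_trans k_ge1.
have k2_gt0 : 0 < k%:~R ^+ 2 :> R by rewrite exprn_even_gt0//= intr_eq0.
rewrite (_ : omega = k%:~R ^+ 2 * (omega / k%:~R ^+ 2)).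
  by apply: global_bifurcation_branch => //; exact: divr_gt0.
by rewrite mulrC divfK// gt_eqF.
Qed.
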